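(* Let $n\ge 1$, let $A\in\mathbb{C}^{n\times n}$, and set $A_0=I_n$, $A_1=\frac{A+A^*}{2}$, $A_2=\frac{A-A^*}{2i}$. Let $p(y)=\det(y_0A_0+y_1A_1+y_2A_2)$, let $\mathcal{P}$ be the algebraic plane curve $p(y)=0$, and let $\mathcal{Q}$ be the set of real points of the algebraic plane curve dual to $\mathcal{P}$. Then, identifying $\mathbb{C}$ with the affine chart $x_0=1$ of the real projective plane via $x_1+ix_2\leftrightarrow(1,x_1,x_2)$, the numerical range $\mathcal{W}(A)=\{w^*Aw : w\in\mathbb{C}^n,\ w^*w=1\}$ satisfies $$\mathcal{W}(A)=\mathrm{conv}\,\mathcal{Q},$$ where the convex hull is taken in this affine chart.
   Context: Here $i$ is the imaginary unit, $I_n$ is the identity matrix of size $n$, $A^*$ is the conjugate transpose, and $\mathrm{conv}$ denotes the set of all convex combinations. The polynomial $p$ is a real form of degree $n$ in $y=(y_0,y_1,y_2)$. The dual curve is understood in the standard sense of algebraic geometry: for each distinct irreducible factor $f$ of $p$ over $\mathbb{C}$, the dual of the curve $f=0$ in $\mathbb{P}^2(\mathbb{C})$ is the Zariski closure in the dual plane $\mathbb{P}^2(\mathbb{C})$ of the set of points with projective coordinates $x=(\partial f(y)/\partial y_0,\partial f(y)/\partial y_1,\partial f(y)/\partial y_2)$, where $y$ runs over the points with $f(y)=0$ and nonzero gradient (when $f$ is linear this is a single point, given by the coefficients of $f$). The dual of $\mathcal{P}$ is the union of these duals over all distinct irreducible factors of $p$, and $\mathcal{Q}$ is the set of its points in the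 real projective plane $\mathbb{P}^2(\mathbb{R})$. *)

(* Defs.v *)
(* MathComp, with the reals as an arbitrary [realType] and C := R[i]. *)
From HB Require Import structures.
From mathcomp Require Import all_boot all_order all_algebra.
From mathcomp Require Import classical_sets reals.
From mathcomp Require Import complex.
From mathcomp Require Import mpoly.

Set Implicit Arguments.
Unset Strict Implicit.
Unset Printing Implicit Defensive.

Import Order.TTheory GRing.Theory Num.Theory.
Local Open Scope ring_scope.
Local Open Scope classical_set_scope.
Local Open Scope sesquilinear_scope.

Section NumericalRange.
Variables (C : numClosedFieldType) (n : nat).

Definition numerical_range (A : 'M[C]_n) : set C :=
  [set z | exists w : 'cV[C]_n,
     w^t* *m w = 1%:M /\ w^t* *m A *m w = z%:M].

Definition pencil_coef0 : 'M[C]_n := 1%:M.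
Definition pencil_coef1 (A : 'M[C]_n) : 'M[C]_n := 2^-1 *: (A + A^t*).
Definition pencil_coef2 (A : 'M[C]_n) : 'M[C]_n :=
  (2 * 'i)^-1 *: (A - A^t*).

Definition pencil_form (A : 'M[C]_n) : {mpoly C[3]} :=
  let lift := map_mx (@mpolyC 3 C) in
  \det ('X_0 *: lift pencil_coef0 + 'X_1 *: lift (pencil_coef1 A)
        + 'X_2 *: lift (pencil_coef2 A)).

End NumericalRange.

Section DualCurve.
Variable F : fieldType.

Definition mdivides (f p : {mpoly F[3]}) : Prop := exists g, p = g * f.

Definition mirreducible (f : {mpoly F[3]}) : Prop :=
  [/\ f != 0, f \isn't a GRing.unit &
      forall g h, f = g * h -> g \is a GRing.unit \/ h \is a GRing.unit].

(* A point of the projective plane is given by any of its nonzero vectors of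
   homogeneous coordinates, and a subset by such vectors. *)
Definition proj_zeros (G : set {mpoly F[3]}) : set 'rV[F]_3 :=
  [set x : 'rV[F]_3 | x != 0 /\ forall g, G g -> g.@[x 0] = 0].

Definition zariski_closed (Z : set 'rV[F]_3) : Prop :=
  exists G : set {mpoly F[3]},
    (forall g, G g -> exists d : nat, g \is d.-homog) /\ Z = proj_zeros G.

Definition zariski_closure (S : set 'rV[F]_3) : set 'rV[F]_3 :=
  smallest zariski_closed S.

Definition gradient (f : {mpoly F[3]}) (y : 'rV[F]_3) : 'rV[F]_3 :=
  \row_k (f^`M(k)).@[y 0].

Definition dual_irreducible (f : {mpoly F[3]}) : set 'rV[F]_3 :=
  zariski_closure
    [set x : 'rV[F]_3 | exists y : 'rV[F]_3,
       [/\ y != 0, f.@[y 0] = 0, gradient f y != 0 & x = gradient f y]].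

(* Irreducible factors are only determined up to units; associated factors have
   proportional gradients, hence the same dual. *)
Definition dual_curve (p : {mpoly F[3]}) : set 'rV[F]_3 :=
  [set x : 'rV[F]_3 | exists f,
     [/\ mirreducible f, mdivides f p & dual_irreducible f x]].

End DualCurve.

Section ComplexPlane.
Variable R : realType.
Local Notation C := R[i].
Local Open Scope complex_scope.

Definition real_dual_points (p : {mpoly C[3]}) : set 'rV[R]_3 :=
  [set x | dual_curve p (map_mx (real_complex R) x)].

(* C is identified with the affine chart x_0 = 1 of the real plane. *)
Definition chart_point (z : C) : 'rV[R]_3 :=
  \row_k [:: 1; complex.Re z; complex.Im z]`_k.

Definition convex_hull (S : set C) : set C :=
  [set z | exists (m : nat) (t : 'I_m -> R) (s : 'I_m -> C),
     [/\ forall j, 0 <= t j, \sum_j t j = 1, forall j, S (s j) &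
         z = \sum_j (t j)%:C * s j]].

End ComplexPlane.

(* Main.v *)
(* Kippenhahn's theorem.  Write p(y) = det M(y) with M(y) = y_0 I + y_1 A_1 + y_2 A_2.

   Real dual points lie in W(A).  W(A) is convex (Toeplitz-Hausdorff) and
   compact, so a point z outside it gives a real e with M(e) >= eta I,
   eta > 0, and e orthogonal to x = (1, Re z, Im z).  Complete e by a real v
   orthogonal to x and by w = (1, 0, 0).  In the coordinates (s, t) of
   y = s e + v + t w a factor f of p becomes a polynomial F(s, t), monic in s
   up to a constant, whose zeros with t real have s real, and along these
   |F_t| <= K |F_s|.  Elimination turns the bound into a polynomial relation
   between t and F_s / F_t which fails at (0, 0).  Since t is an eigenvalue of a
   matrix depending polynomially on the line tangent at y, the relation becomes
   a polynomial in x which vanishes on all gradients of f but not at x, so x is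
   not in the Zariski closure.

   W(A) is contained in the hull of the real dual points.  For all but finitely
   many real c the root s = - lambda of p(s, 1, c), lambda being the largest (or
   least) eigenvalue of A_1 + c A_2, is a simple root of an irreducible factor
   of p; the gradient there is proportional to a real dual point on the support
   line Re + c Im = lambda of W(A).  The set of convex combinations of three
   dual points contains a point nearest to z in W(A); were it not z, slightly
   tilting the separating direction to one of the generic ones would contradict
   the existence of these points. *)

Require Import Defs.
From mathcomp Require Import all_boot all_order all_algebra.
From mathcomp Require boolp classical_sets reals topology normedtype derive.
From mathcomp Require mpoly.

Set Implicit Arguments.
Unset Strict Implicit.
Unset Printing Implicit Defensive.

(** The obstacle is the Zariski closure over the complex numbers: a real dual point need not be a
    limit of real tangents, so an argument with real tangent lines alone cannot exclude it. What
    excludes it is a polynomial vanishing at all complex gradients. The slope bound holds only for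
    real t, but the slopes above t are roots of a polynomial over C[t], and its divisibility by a
    power of t is already decided by its size at small positive t. This is how an estimate on the
    real line governs complex tangents. The relation has to fail at (0, 0) because x is orthogonal
    to e and v: a tangent line with the coordinates of x has F_s = 0 and meets the frame at t = 0.
    The choice w = (1, 0, 0) gives M(w) = I, which makes t minus an eigenvalue of s M(e) + M(v). In
    the other inclusion three points suffice in the plane; fixing their number presents the hull as
    the image of a bounded real algebraic set, on which the distance to z attains its minimum.
    Generic c are needed because at a multiple root of a factor the gradient may vanish and yield no
    dual point. *)

Module Compactness.
Import boolp classical_sets reals topology normedtype derive.
Import Order.TTheory GRing.Theory Num.Theory numFieldNormedType.Exports.
Local Open Scope ring_scope.
Local Open Scope classical_set_scope.

(** * Minima of real polynomials on bounded real algebraic sets *)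

Section MinOnZeros.
Variables (R : realType) (N : nat).

Let continuous_ext (f g : 'rV[R]_N -> R) : f =1 g -> continuous f -> continuous g.
Proof. by move=> /funext->. Qed.

Let continuous_sum (I : Type) (r : seq I) (F : I -> 'rV[R]_N -> R) :
  (forall i, continuous (F i)) -> continuous (fun x => \sum_(i <- r) F i x).
Proof.
move=> cF; elim: r => [|i r IHr].
  by apply: (@continuous_ext (fun=> 0)); [move=> x; rewrite big_nil | exact: cst_continuous].
apply: (@continuous_ext (fun x => F i x + \sum_(i <- r) F i x)) => x.
  by rewrite big_cons.
exact: (continuousD (cF i x) (IHr x)).
Qed.

Let continuous_prod (I : Type) (r : seq I) (F : I -> 'rV[R]_N -> R) :
  (forall i, continuous (F i)) -> continuous (fun x => \prod_(i <- r) F i x).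
Proof.
move=> cF; elim: r => [|i r IHr].
  by apply: (@continuous_ext (fun=> 1)); [move=> x; rewrite big_nil | exact: cst_continuous].
apply: (@continuous_ext (fun x => F i x * \prod_(i <- r) F i x)) => x.
  by rewrite big_cons.
exact: (continuousM (cF i x) (IHr x)).
Qed.

Lemma meval_continuous (p : mpoly.mpoly N R) :
  continuous (fun x : 'rV[R]_N => mpoly.meval (x 0) p).
Proof.
apply: (@continuous_ext (fun x : 'rV[R]_N => \sum_(m <- mpoly.msupp p)
    mpoly.mcoeff m p * \prod_i x 0 i ^+ (mpoly.fun_of_multinom m i))).
  by move=> x; rewrite mpoly.mevalE.
apply: continuous_sum => m x; apply: continuousM; first exact: cst_continuous.
apply: continuous_prod => i {}x.
elim: (mpoly.fun_of_multinom m i) x => [|k IHk]; first exact: cst_continuous.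
apply: (@continuous_ext (fun v : 'rV[R]_N => v 0 i * v 0 i ^+ k)) => x.
  by rewrite exprS.
exact: (continuousM (@coord_continuous _ _ _ 0 i x) (IHk x)).
Qed.

(** The zero set is closed and lies in a product of segments, hence is compact. The interface is
    purely algebraic, so that the topology stays inside this module. *)
Lemma min_on_bounded_zeros (G : set (mpoly.mpoly N R)) (q : mpoly.mpoly N R) (B : R) :
  let Z (x : 'rV[R]_N) := forall g, G g -> mpoly.meval (x 0) g = 0 in
  (exists x, Z x) -> (forall x, Z x -> forall i, `|x 0 i| <= B) ->
  exists2 x, Z x & forall y, Z y -> mpoly.meval (x 0) q <= mpoly.meval (y 0) q.
Proof.
move=> Z [x0 Zx0] bnd.
have cZ : closed (Z : set 'rV[R]_N).
  have -> : (Z : set 'rV[R]_N) =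
      \bigcap_(g in G) ((fun x : 'rV[R]_N => mpoly.meval (x 0) g) @^-1` [set 0]).
    by [].
  apply: closed_bigI => g _; apply: closed_comp; last exact: closed_eq.
  by move=> x _; exact: meval_continuous.
have kZ : compact (Z : set 'rV[R]_N).
  have cB : compact [set v : 'rV[R]_N | forall i, `[- B, B] (v ord0 i)].
    by apply: (@rV_compact _ _ (fun=> `[- B, B])) => _; exact: segment_compact.
  apply: subclosed_compact cZ cB _ => y Zy i /=.
  by rewrite in_itv /= -ler_norml bnd.
have [x /set_mem Zx xmin] := @EVT_min_rV _ _ (fun x => mpoly.meval (x 0) q) Z
   (ex_intro _ x0 Zx0) kZ (continuous_subspaceT (@meval_continuous q)).
by exists x => // y Zy; apply: xmin; rewrite inE.
Qed.

End MinOnZeros.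
End Compactness.

From mathcomp Require Import boolp classical_sets reals complex mpoly polyXY.
From mathcomp Require Import ring lra zify.
Import Order.TTheory GRing.Theory Num.Theory.
Local Open Scope ring_scope.
Local Open Scope sesquilinear_scope.
Local Open Scope classical_set_scope.

(** * Plane curves with real zeros over the real line *)

Section Univariate.
Variable C : numClosedFieldType.
Implicit Types (q : {poly C}).

Lemma poly_bounded_disk q :
  exists2 M : C, 0 <= M & forall x, `|x| <= 1 -> `|q.[x]| <= M.
Proof.
elim/poly_ind: q => [|q c [M M0 hM]].
  by exists 0 => // x _; rewrite horner0 normr0.
exists (M + `|c|); first by rewrite addr_ge0.
move=> x x1; rewrite hornerMXaddC (le_trans (ler_normD _ _)) // lerD2r normrM.
by rewrite -[M]mulr1 ler_pM // hM.
Qed.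

(** q'(0) / q(0) is minus the sum of the inverses of the roots, each of modulus at most 1/r.
    Induction on the list of roots avoids the division. *)
Lemma log_deriv_bound q (r : C) : 0 < r ->
  (forall z, `|z| < r -> q.[z] != 0) ->
  `|q^`().[0]| * r <= (size q)%:R * `|q.[0]|.
Proof.
move=> r0 hq.
have qN0 : q != 0 by apply: contraTneq (hq 0 _); rewrite ?normr0 // => ->; rewrite horner0 eqxx.
have [s qE] := closed_field_poly_normal q.
have hs z : z \in s -> r <= `|z|.
  move=> zs; rewrite real_leNgt ?normr_real ?gtr0_real //; apply/negP => zr.
  move: (hq z zr); rewrite qE hornerZ mulf_eq0 negb_or => /andP[_].
  by rewrite -[_ == 0]/(root _ z) root_prod_XsubC zs.
have -> : size q = (size s).+1.
  by rewrite qE size_scale ?lead_coef_eq0 // size_prod_XsubC.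
rewrite qE derivZ !hornerZ !normrM -mulrA [leRHS]mulrCA ler_wpM2l //.
elim: s hs {qE} => [|z s IHs] hs.
  by rewrite big_nil derivC hornerC normr0 mul0r hornerC normr1 mulr_ge0.
rewrite big_cons derivM derivXsubC mul1r hornerD !hornerM hornerXsubC sub0r.
set P := \prod_(_ <- s) _ in IHs *.
have zr : r <= `|z| by apply: hs; rewrite mem_head.
have {}IHs : `|P^`().[0]| * r <= (size s).+1%:R * `|P.[0]|.
  by apply: IHs => x xs; rewrite hs // inE xs orbT.
rewrite (le_trans (ler_wpM2r (ltW r0) (ler_normD _ _))) // mulrDl.
rewrite -[(size _).+1]add1n natrD mulrDl mul1r !normrM normrN lerD //.
  by rewrite mulrC ler_wpM2r.
by rewrite -mulrA [leRHS]mulrCA ler_wpM2l.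
Qed.

Lemma exists_small_nonroot q (e : C) : q != 0 -> 0 < e ->
  exists x, [/\ 0 < x, x <= e & q.[x] != 0].
Proof.
(* These [size q] distinct candidates are one more than q can have as roots. *)
move=> q0 e0; pose s := [seq e / k.+1%:R | k <- iota 0 (size q)].
have /allPn[x] : ~~ all (root q) s.
  apply: contraL (leqnn (size q)) => hs; rewrite -ltnNge.
  have := max_poly_roots q0 hs; rewrite size_map size_iota; apply.
  rewrite map_inj_uniq ?iota_uniq // => i j /(mulfI (lt0r_neq0 e0)) /invr_inj.
  by move/eqP; rewrite eqr_nat => /eqP[].
move=> /mapP[k _ ->] h; exists (e / k.+1%:R); split => //; first by rewrite divr_gt0 ?ltr0n.
by rewrite ler_pdivrMr ?ltr0n // ler_peMr ?ler1n // ltW.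
Qed.

(** If 0 were a root of order j < N, dividing the bound by x^j would make the cofactor's value at 0
    at most a constant times x for arbitrarily small x, hence 0. The polynomial w leaves room for
    finitely many exceptional x. *)
Lemma Xn_dvd_of_small (q w : {poly C}) (M : C) N : w != 0 ->
  (forall x, 0 < x -> x <= 1 -> w.[x] != 0 -> `|q.[x]| <= M * x ^+ N) ->
  exists q1, q = 'X^N * q1.
Proof.
move=> w0 hq; have [->|q0] := eqVneq q 0; first by exists 0; rewrite mulr0.
have [j [q1 q1N0 qE]] : exists j, exists2 q1, q1.[0] != 0 & q = 'X^j * q1.
  have [j [q1 h1 h2]] := multiplicity_XsubC q 0.
  by exists j, q1; [move: h1; rewrite q0 | rewrite mulrC h2 subr0].
have [Nj|jN] := leqP N j.
  by exists ('X^(j - N) * q1); rewrite mulrA -exprD subnKC.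
exfalso.
have M0 : 0 <= M.
  have [x [x0 x1 wx]] := exists_small_nonroot w0 ltr01.
  by have := le_trans (normr_ge0 _) (hq x x0 x1 wx); rewrite pmulr_lge0 // exprn_gt0.
have [M2 M20 hM2] := poly_bounded_disk (drop_poly 1 q1).
have h x : 0 < x -> x <= 1 -> w.[x] != 0 -> `|q1.[0]| <= (M + M2) * x.
  move=> x0 x1 wx; have := hq x x0 x1 wx.
  rewrite qE hornerM hornerXn normrM normrX (gtr0_norm x0) -(subnKC (ltnW jN)) exprD.
  rewrite mulrCA ler_pM2l ?exprn_gt0 // => hx.
  have q1E : q1.[x] = q1.[0] + (drop_poly 1 q1).[x] * x.
    rewrite -{1}(poly_take_drop 1 q1) !hornerE.
    by rewrite (size1_polyC (size_take_poly 1 q1)) !hornerC coef_take_poly /= horner_coef0.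
  have -> : q1.[0] = q1.[x] - (drop_poly 1 q1).[x] * x by rewrite q1E addrK.
  rewrite (le_trans (ler_normB _ _)) // mulrDl lerD //.
    rewrite (le_trans hx) // ler_wpM2l //.
    by rewrite -[leRHS]expr1 ler_wiXn2l ?subn_gt0 // ltW.
  by rewrite normrM (gtr0_norm x0) ler_wpM2r ?(ltW x0) // hM2 // gtr0_norm.
set a := `|q1.[0]| in h; have a0 : 0 < a by rewrite normr_gt0.
(* With this denominator, x <= a / (M + M2 + 1 + a) gives both x <= 1 and (M + M2) x < a. *)
have MM : 0 < M + M2 + 1 + a by rewrite !ltr_wpDl ?addr_ge0 ?ler01.
have [x [x0 xe wx]] := exists_small_nonroot w0 (divr_gt0 a0 MM).
have x1 : x <= 1.
  by rewrite (le_trans xe) // ler_pdivrMr // mul1r lerDr !addr_ge0.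
suff lt : (M + M2) * x < a by have := le_lt_trans (h x x0 x1 wx) lt; rewrite ltxx.
rewrite (le_lt_trans (ler_wpM2l _ xe)) ?addr_ge0 // mulrA ltr_pdivrMr // mulrC.
by rewrite ltr_pM2l // -addrA ltrDl addr_gt0.
Qed.

End Univariate.

(** * Gauss's lemma over C[y] *)

Section Gauss.
Variable C : closedFieldType.
Implicit Types (k : {poly C}) (F D H : {poly {poly C}}).

Lemma dvd_XsubC_coef (c : C) D : map_poly (horner_eval c) D = 0 ->
  exists D1, D = ('X - c%:P) *: D1.
Proof.
move=> D0; exists (\poly_(i < size D) (D`_i %/ ('X - c%:P))).
apply/polyP => i; rewrite coefZ coef_poly; case: ltnP => iD; last first.
  by rewrite mulr0 nth_default.
rewrite mulrC Pdiv.Field.divpK // Pdiv.Field.dvdp_XsubCl.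
by apply/rootP; have := congr1 (fun p : {poly C} => p`_i) D0; rewrite coef_map coef0.
Qed.

Lemma poly_scalerI (k : {poly C}) : k != 0 -> injective (fun F => k *: F).
Proof. by move=> k0 F G; rewrite -!mul_polyC => /mulfI; apply; rewrite polyC_eq0. Qed.

(** One root c of k at a time: at y = c the product D H vanishes, so y - c divides all coefficients
    of D or all those of H and can be cancelled. Only nonzero scalars are removed, hence the sizes
    stay. *)
Lemma gauss_cancel k F D H : k != 0 -> k *: F = D * H ->
  exists D' H', [/\ F = D' * H', size D' = size D & size H' = size H].
Proof.
elim: {k}(size k) {-2}k (leqnn (size k)) D H => [|m IHm] k.
  by rewrite leqn0 size_poly_eq0 => /eqP->; rewrite eqxx.
move=> km D H k0 kF; have [k1|/closed_rootP[c]] := boolP (size k == 1%N).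
  have [a a0 ka] := size_poly1P _ k1.
  have ka1 : a^-1%:P * k = 1 by rewrite ka -polyCM mulVf.
  exists (a^-1%:P *: D), H; split => //.
    by rewrite -scalerAl -kF scalerA ka1 scale1r.
  by rewrite size_scale // polyC_eq0 invr_eq0.
rewrite -Pdiv.Field.dvdp_XsubCl => /Pdiv.Field.dvdpP[k1 kE].
have X0 := polyXsubC_eq0 c.
have k10 : k1 != 0 by apply: contraNneq k0 => k10; rewrite kE k10 mul0r.
have k1m : (size k1 <= m)%N.
  by move: km; rewrite kE size_Mmonic ?monicXsubC // size_XsubC addn2.
have : map_poly (horner_eval c) D * map_poly (horner_eval c) H = 0.
  rewrite -rmorphM -kF; apply/polyP => i; rewrite coef_map coefZ coef0 /=.
  by rewrite /horner_eval kE !hornerM hornerXsubC subrr mulr0 mul0r.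
move/eqP; rewrite mulf_eq0 => /orP[] /eqP /dvd_XsubC_coef [E hE].
  have /IHm[] // : k1 *: F = E * H.
    apply: (@poly_scalerI ('X - c%:P)); first by rewrite X0.
    by rewrite scalerAl -hE scalerA mulrC -kE.
  move=> D' [H' [h1 h2 h3]]; exists D', H'; split => //.
  by rewrite h2 hE size_scale // X0.
have /IHm[] // : k1 *: F = D * E.
  apply: (@poly_scalerI ('X - c%:P)); first by rewrite X0.
  by rewrite scalerAr -hE scalerA mulrC -kE.
move=> D' [H' [h1 h2 h3]]; exists D', H'; split => //.
by rewrite h3 hE size_scale // X0.
Qed.

(** The gcd with the derivative is a proper factor. Over C[y] it divides F only up to a scalar k,
    which [gauss_cancel] removes. *)
Lemma gauss_monic F : F \is monic -> (1 < size F)%N -> F^`() != 0 ->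
  ~~ coprimep F F^`() ->
  exists D H, [/\ F = D * H, D \is monic & H \is monic] /\
     ((1 < size D)%N /\ (1 < size H)%N).
Proof.
move=> Fm F1 F'0; rewrite coprimep_def => gn1.
set g := gcdp _ _ in gn1.
have F0 := monic_neq0 Fm.
have g0 : g != 0 by rewrite gcdp_eq0 negb_and F0.
have /Pdiv.Idomain.dvdpP[[k H] /= k0 kF] : Pdiv.Idomain.dvdp g F by exact: dvdp_gcdl.
have sg : (size g < size F)%N.
  apply: (leq_ltn_trans _ (lt_size_deriv F0)).
  by apply: dvdp_leq => //; exact: dvdp_gcdr.
have H0 : H != 0.
  apply: contraNneq F0 => H0; move: kF; rewrite H0 mul0r -mul_polyC => /eqP.
  by rewrite mulf_eq0 polyC_eq0 (negPf k0).
have [H' [D' [FE sH sD]]] := gauss_cancel k0 kF.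
have lE : lead_coef H' * lead_coef D' = 1 by rewrite -lead_coefM -FE (monicP Fm).
have l0 : lead_coef D' != 0.
  by apply: contraTneq (oner_neq0 {poly C}) => l0; rewrite -lE l0 mulr0 eqxx.
have l1 : lead_coef H' != 0.
  by apply: contraTneq (oner_neq0 {poly C}) => l1; rewrite -lE l1 mul0r eqxx.
have sHF : (size H + size g = (size F).+1)%N.
  have := congr1 (fun p : {poly {poly C}} => size p) kF.
  rewrite size_scale // size_mul // => ->; rewrite prednK //.
  by rewrite addn_gt0 size_poly_gt0 H0.
(* The two leading coefficients have product 1, so scaling each factor by the other's makes both
   monic and keeps the product. *)
exists (lead_coef D' *: H'), (lead_coef H' *: D'); split; [split|].
- by rewrite -scalerAl -scalerAr scalerA mulrC lE scale1r.
- by rewrite monicE lead_coefZ mulrC lE.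
- by rewrite monicE lead_coefZ lE.
rewrite !size_scale // sH sD; split.
  by rewrite -(ltn_add2r (size g)) sHF add1n ltnS.
by rewrite ltn_neqAle eq_sym gn1 size_poly_gt0.
Qed.

End Gauss.

Section TangentSlopes.
Variable C : numClosedFieldType.
Implicit Types (F : {poly {poly C}}) (p q : {poly C}).

(** In [F.[x, y]] the outer variable takes x and the inner one y; in a frame these are the s and t
    of the overview. This is the derivative in the inner variable. *)
Definition derivY F : {poly {poly C}} := swapXY (swapXY F)^`().

Lemma derivYM F G : derivY (F * G) = derivY F * G + F * derivY G.
Proof. by rewrite /derivY rmorphM /= derivM rmorphD !rmorphM /= !swapXYK. Qed.

Lemma derivYZ (a : C) F : derivY (a%:P *: F) = a%:P *: derivY F.
Proof.
rewrite -!mul_polyC derivYM [derivY _%:P]/derivY swapXY_polyC map_polyC derivC.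
by rewrite raddf0 mul0r add0r.
Qed.

Lemma horner_derivY F (x y : C) : (derivY F).[x, y] = (F.[x%:P])^`().[y].
Proof. by rewrite /derivY horner_swapXY -deriv_map -horner_polyC. Qed.

Lemma horner_derivX F (x y : C) :
  (F^`()).[x, y] = (map_poly (horner_eval y) F)^`().[x].
Proof.
by rewrite -[F in LHS]swapXYK -[(swapXY _)^`()]swapXYK -/(derivY _) horner2_swapXY
  horner_derivY horner_swapXY.
Qed.

Lemma horner2_eval F (x y : C) : F.[x, y] = (map_poly (horner_eval y) F).[x].
Proof. by rewrite -horner_swapXY horner2_swapXY. Qed.

Lemma poly_lipschitz0 p :
  exists2 M : C, 0 <= M & forall x, `|x| <= 1 -> `|p.[x] - p.[0]| <= M * `|x|.
Proof.
have [M M0 hM] := poly_bounded_disk (drop_poly 1 p).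
exists M => // x x1.
have -> : p.[x] = p.[0] + (drop_poly 1 p).[x] * x.
  rewrite -{1}(poly_take_drop 1 p) !hornerE.
  by rewrite (size1_polyC (size_take_poly 1 p)) !hornerC coef_take_poly /= horner_coef0.
by rewrite addrAC subrr add0r normrM ler_wpM2r // hM.
Qed.

(** Passage to the limit e -> 0, carried out with Lipschitz constants at 0 instead of a topology. *)
Lemma le_norm_at0 p q :
  (forall e, 0 < e -> `|p.[e]| <= `|q.[e]|) -> `|p.[0]| <= `|q.[0]|.
Proof.
move=> pq; have [//|qp] := real_leP (normr_real p.[0]) (normr_real q.[0]).
have [M M0 hM] := poly_lipschitz0 p; have [N N0 hN] := poly_lipschitz0 q.
set a := `|p.[0]| - `|q.[0]|; have a0 : 0 < a by rewrite subr_gt0.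
have MN : 0 < M + N + 1 + a by rewrite ltr_wpDl ?addr_ge0 ?ler01.
set e := a / (M + N + 1 + a).
have e0 : 0 < e by rewrite divr_gt0.
have e1 : `|e| <= 1.
  by rewrite gtr0_norm // ler_pdivrMr // mul1r lerDr !addr_ge0.
suff lt : (M + N) * e < a.
  have : a <= (M + N) * e.
    have pe : `|p.[0]| <= `|p.[e]| + M * e.
      have := hM e e1; rewrite (gtr0_norm e0) distrC => h.
      by rewrite -[p.[0]](subrK p.[e]) addrC (le_trans (ler_normD _ _)) // lerD2l.
    have qe : `|q.[e]| <= `|q.[0]| + N * e.
      have := hN e e1; rewrite (gtr0_norm e0) => h.
      by rewrite -[q.[e]](subrK q.[0]) addrC (le_trans (ler_normD _ _)) // lerD2l.
    rewrite /a lerBlDr mulrDl (le_trans pe) // addrC -addrA lerD2l [leRHS]addrC.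
    exact: le_trans (pq e e0) qe.
  by move=> /le_lt_trans/(_ lt); rewrite ltxx.
by rewrite mulrA ltr_pdivrMr // mulrC ltr_pM2l // -addrA ltrDl addr_gt0.
Qed.

Lemma norm_Im_le (z : C) : `|'Im z| <= `|z|.
Proof. by have := (leif_normC_Re_Creal ('i * z)).1; rewrite ReMil normrN normrM normCi mul1r. Qed.

(* Satisfied by F(x, y) = det (x H + K + y I) for H >= eta I and K hermitian. *)
Definition hyperbolic_slope (eta : C) F :=
  forall x y, `|'Im y| < eta * `|'Im x| -> F.[x, y] != 0.

(** Move x off the real line to x + i e. Then F(x + i e, .) has no zero within eta e of y, and
    [log_deriv_bound] bounds |F_y| by [sizeY F] / (eta e) times |F(x + i e, y)|. As F(x, y) = 0,
    that value is i e times a cofactor which becomes F_x(x, y) at e = 0. *)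
Lemma hyperbolic_slope_bound eta F : 0 < eta -> hyperbolic_slope eta F ->
  exists2 K : C, 0 <= K & forall x y, y \is Num.real -> F.[x, y] = 0 ->
    `|(derivY F).[x, y]| <= K * `|(F^`()).[x, y]|.
Proof.
move=> eta0 hF; exists ((sizeY F)%:R / eta); first by rewrite divr_ge0 // ltW.
move=> x y yr Fxy.
have xr : x \is Num.real.
  apply/Creal_ImP/eqP; apply: contraT => xI.
  by have := hF x y; rewrite Fxy (Creal_ImP _ yr) normr0 eqxx mulr_gt0 ?normr_gt0 // => /(_ isT).
have xI : 'Im x = 0 by apply/Creal_ImP.
have yI : 'Im y = 0 by apply/Creal_ImP.
set Fy := map_poly (horner_eval y) F.
have /factor_theorem[h Fyh] : root Fy x by rewrite /root -horner2_eval Fxy.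
(* Both sides of the estimate, as polynomials in e. *)
pose P := (swapXY (derivY F)).[y%:P] \Po (x%:P + 'i *: 'X).
pose Q := ((sizeY F)%:R / eta)%:P * (h \Po (x%:P + 'i *: 'X)).
have lin (e : C) : (x%:P + 'i *: 'X).[e] = x + 'i * e by rewrite !hornerE.
have PE e : P.[e] = (derivY F).[x + 'i * e, y].
  by rewrite horner_comp lin horner2_swapXY.
have QE e : Q.[e] = (sizeY F)%:R / eta * h.[x + 'i * e].
  by rewrite hornerM hornerC horner_comp lin.
have := @le_norm_at0 P Q; rewrite PE QE mulr0 addr0 => le0.
rewrite (le_trans (le0 _)) //; last first.
  rewrite normrM ger0_norm ?divr_ge0 ?(ltW eta0) //.
  rewrite horner_derivX -/Fy Fyh derivM derivXsubC mulr1 !hornerE subrr mulr0 add0r.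
  by [].

move=> e e0; rewrite PE QE horner_derivY.
pose q := F.[(x + 'i * e)%:P] \Po ('X + y%:P).
have r0 : 0 < eta * e by rewrite mulr_gt0.
have := @log_deriv_bound _ q _ r0.
have -> : q^`().[0] = (F.[(x + 'i * e)%:P])^`().[y].
  by rewrite deriv_comp !derivE addr0 mulr1 horner_comp !hornerE.
have -> : q.[0] = 'i * e * h.[x + 'i * e].
  by rewrite horner_comp !hornerE horner2_eval -/Fy Fyh hornerM hornerXsubC mulrC addrAC subrr add0r.
move=> hb.
have : `|F.[(x + 'i * e)%:P]^`().[y]| * (eta * e) <= (sizeY F)%:R * `|'i * e * h.[x + 'i * e]|.
  apply: (le_trans (hb _)) => [z hz|].
    rewrite horner_comp !hornerE; apply: hF.
    rewrite raddfD /= yI addr0 (Im_rect xr (gtr0_real e0)) (gtr0_norm e0).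
    exact: le_lt_trans (norm_Im_le z) hz.
  by rewrite ler_wpM2r // ler_nat size_comp_poly2 ?size_XaddC // max_size_evalC.
rewrite !normrM normCi mul1r (gtr0_norm e0) normr_nat normfV (gtr0_norm eta0).
by rewrite [X in X <= _]mulrA [X in _ <= X -> _]mulrCA [X in _ <= X -> _]mulrC ler_pM2r //
  mulrAC ler_pdivlMr.
Qed.

End TangentSlopes.

Section CompanionMatrix.
Variable C : numClosedFieldType.
Implicit Types (F : {poly {poly C}}) (p q : {poly C}).

(** Realizing F as a characteristic polynomial replaces computation modulo F by evaluation at a
    matrix. *)
Lemma monic_char_poly (R : comNzRingType) (p : {poly R}) :
  p \is monic -> (1 < size p)%N ->
  exists n, exists2 N : 'M[R]_n.+1, char_poly N = p & size p = n.+2.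
Proof.
move=> pm p1; have := companionmxK pm.
move: (companionmx p); have -> : (size p).-1 = (size p).-2.+1 by case: size p1 => [|[]].
by move=> N NE; exists (size p).-2, N => //; case: size p1 => [|[]].
Qed.

Lemma root_char_poly_horner n (N : 'M[C]_n.+1) q x :
  root (char_poly N) x -> root (char_poly (horner_mx N q)) q.[x].
Proof.
rewrite -!eigenvalue_root_char => /eigenvalueP[v vN v0].
apply/eigenvalueP; exists v => //.
elim/poly_ind: q => [|q c IH]; first by rewrite rmorph0 mulmx0 horner0 scale0r.
rewrite rmorphD rmorphM /= horner_mx_X horner_mx_C mulmxDr mulmxA IH -scalemxAl vN.
by rewrite scalerA mul_mx_scalar -scalerDl hornerMXaddC.
Qed.

(** If q - z were coprime to the characteristic polynomial, a Bezout relation evaluated at N would,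
    by Cayley-Hamilton, kill the eigenvector. *)
Lemma char_poly_horner_root n (N : 'M[C]_n.+1) q z :
  root (char_poly (horner_mx N q)) z ->
  exists2 x, root (char_poly N) x & z = q.[x].
Proof.
rewrite -eigenvalue_root_char => /eigenvalueP[v vN v0].
have : ~~ coprimep (char_poly N) (q - z%:P).
  apply/negP => /Bezout_eq1_coprimepP[[u w] /= uw].
  have := congr1 (fun p => v *m horner_mx N p) uw.
  rewrite rmorph1 mulmx1 rmorphD !rmorphM /= Cayley_Hamilton mulr0 add0r.
  rewrite (comm_horner_mx2 N w) -mulmxE mulmxA.
  rewrite rmorphB /= horner_mx_C mulmxBr vN mul_mx_scalar subrr mul0mx => /esym v0'.
  by rewrite v0' eqxx in v0.
rewrite coprimep_def => /closed_rootP[x]; rewrite root_gcd => /andP[r1 r2].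
exists x => //; move: r2; rewrite rootE !hornerE subr_eq0 => /eqP->; by [].
Qed.

Lemma inner_Xn_dvd (G : {poly {poly C}}) k :
  (forall x, exists q, G.[x%:P] = 'X^k * q) -> exists G1, G = ('X^k)%:P * G1.
Proof.
move=> hG; exists (swapXY (drop_poly k (swapXY G))).
have swG : swapXY G = drop_poly k (swapXY G) * 'X^k; last first.
  by rewrite -[LHS]swapXYK {1}swG rmorphM rmorphXn /= swapXY_X -rmorphXn /= mulrC.
rewrite -[LHS](poly_take_drop k) [take_poly _ _](_ : _ = 0) ?add0r //.
apply/polyP => i; rewrite coef_take_poly coef0; case: ltnP => // ik.
apply/eqP; rewrite -[_ == _]negbK; apply/negP => h0.
have [x [_ _ /negP[]]] := exists_small_nonroot h0 ltr01.
have [q] := hG x; rewrite horner_polyC => /(congr1 (fun p : {poly C} => p`_i)).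
by rewrite coef_map coefXnM ik => /eqP.
Qed.

(** Reversing the coefficients turns a relation satisfied by 1/a into one satisfied by a; the value
    at the origin comes from the former top coefficient. *)
Lemma reverse_relation (G : {poly {poly C}}) d :
  (size G <= d.+1)%N -> exists w : {poly {poly C}},
  [/\ w.[0, 0] = (G`_d).[0] & forall a c, a != 0 -> w.[a, c] = a ^+ d * G.[a^-1, c]].
Proof.
move=> sG; exists (\poly_(k < d.+1) G`_(d - k)); split.
  by rewrite polyC0 !horner_coef0 coef_poly /= subn0.
move=> a c a0; rewrite !horner2_eval.
rewrite (@horner_coef_wide _ d.+1); last by rewrite (leq_trans (size_poly _ _)) // size_poly.
rewrite (@horner_coef_wide _ d.+1 _ a^-1); last by rewrite (leq_trans (size_poly _ _)).
rewrite (reindex_inj rev_ord_inj) /= big_distrr; apply: eq_bigr => i _ /=.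
rewrite !coef_map coef_poly /= subSS ltnS leq_subr.
have iD : (i <= d)%N by rewrite -ltnS.
rewrite subKn // mulrCA; congr (_ * _).
by rewrite exprVn expfB_cond ?(negPf a0) ?iD.
Qed.

End CompanionMatrix.

Section TangentRelation.
Variable C : numClosedFieldType.
Implicit Types (F : {poly {poly C}}) (p q : {poly C}).

Lemma horner2_comp F p (c : C) : F.[p].[c] = F.[p.[c], c].
Proof.
elim/poly_ind: F => [|F a IH]; first by rewrite !horner0.
by rewrite !hornerMXaddC !hornerD !hornerM IH hornerC.
Qed.

Lemma norm_prod_XsubC_le (s : seq C) (a B : C) :
  (forall z, z \in s -> `|a - z| <= B) ->
  `|(\prod_(z <- s) ('X - z%:P)).[a]| <= B ^+ size s.
Proof.
elim: s => [|z s IHs] hs; first by rewrite big_nil hornerC normr1.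
rewrite big_cons hornerM normrM exprS hornerXsubC ler_pM //.
  by rewrite hs // mem_head.
by apply: IHs => t ts; rewrite hs // inE ts orbT.
Qed.

(* w certifies that the tangent lines of F = 0 do not accumulate at y = 0. *)
Definition tangent_relation F :=
  exists2 w : {poly {poly C}}, w.[0, 0] != 0 &
    forall x y, F.[x, y] = 0 -> (derivY F).[x, y] != 0 ->
      w.[- ((F^`()).[x, y] / (derivY F).[x, y]), y] = 0.

(** Where F vanishes, the gradient of F G is G times that of F, so the ratio of the two partial
    derivatives is the one for F. *)
Lemma tangent_relation_mul F G :
  tangent_relation F -> tangent_relation G -> tangent_relation (F * G).
Proof.
move=> [u u0 hu] [v v0 hv]; exists (u * v).
  by rewrite !hornerM mulf_neq0.
move=> x y; rewrite !hornerM => /eqP.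
rewrite mulf_eq0 derivYM derivM !hornerD !hornerM => /orP[] /eqP z0; rewrite z0.
  rewrite !mul0r !addr0 mulf_eq0 negb_or => /andP[d0 G0].
  by rewrite -mulf_div divff // mulr1 hu // mul0r.
rewrite !mulr0 !add0r mulf_eq0 negb_or => /andP[F0 d0].
by rewrite -mulf_div divff // mul1r hv // mulr0.
Qed.

(* If U F + V F_x = rho(y), then - F_y / F_x = Q / rho on the curve, with
   Q = - F_y V.  The characteristic polynomial psi of Q modulo F gives
   psi(rho X, y), which kills - F_y / F_x.  As F_y / F_x is bounded for real y,
   it is divisible by the power of y in rho ^ d, and reversing the quotient
   relates y to - F_x / F_y.  The zeros of rho are treated separately. *)
Lemma tangent_relation_coprime eta F : 0 < eta -> hyperbolic_slope eta F ->
  F \is monic -> (1 < size F)%N -> coprimep F F^`() -> tangent_relation F.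
Proof.
move=> eta0 hF Fm F1 /Pdiv.Idomain.Bezout_coprimepP[[U V] /=].
rewrite -size_poly_eq1 => /size_poly1P[rho rho0 UV].
have [K K0 hK] := hyperbolic_slope_bound eta0 hF.
have VF x y : F.[x, y] = 0 -> V.[x, y] * (F^`()).[x, y] = rho.[y].
  move=> Fxy; have := congr1 (fun p : {poly {poly C}} => p.[x, y]) UV.
  by rewrite hornerC !hornerD !hornerM Fxy mulr0 add0r.
have [r [rho1 rho10 rhoE]] : exists r, exists2 rho1, rho1.[0] != 0 & rho = 'X^r * rho1.
  have [r [rho1 h1 h2]] := multiplicity_XsubC rho 0.
  by exists r, rho1; [move: h1; rewrite rho0 | rewrite mulrC h2 subr0].
have [n [N NE sF]] := monic_char_poly Fm F1.
set d := n.+1.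
pose Q := - (derivY F * V).
pose psi := char_poly (horner_mx N Q).
pose ev (c : C) := map_poly (horner_eval c).
have psiE c : ev c psi = char_poly (horner_mx (map_mx (horner_eval c) N) (ev c Q)).
  by rewrite /ev map_char_poly map_horner_mx.
have FE c : ev c F = char_poly (map_mx (horner_eval c) N).
  by rewrite /ev -NE map_char_poly.
have psi_root x c : F.[x, c] = 0 -> psi.[Q.[x, c], c] = 0.
  rewrite !horner2_eval -!/(ev c _) psiE => Fxc; apply/rootP/root_char_poly_horner.
  by rewrite -FE; apply/rootP.
have root_psi z c : root (ev c psi) z -> exists2 x, F.[x, c] = 0 & z = Q.[x, c].
  rewrite psiE => /char_poly_horner_root[x]; rewrite -FE => /rootP Fx ->.
  by exists x; rewrite horner2_eval.
have spsi : size psi = d.+1 by rewrite size_char_poly.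
pose Psi := psi \Po (rho *: 'X).
have PsiE x c : Psi.[x, c] = psi.[rho.[c] * x, c].
  by rewrite /Psi horner_comp hornerZ hornerX horner2_comp hornerM hornerC.
(* For 0 < c <= 1 the roots of psi(., c) are values of - F_y V, of modulus at most K |F_x V| = K
   |rho(c)|. So Psi(x, c), a product of d factors rho(c) x - z, is bounded by a constant times c^(r
   d). *)
have dvdPsi x : exists q, Psi.[x%:P] = 'X^(r * d) * q.
  have [M M0 hM] := poly_bounded_disk rho1.
  apply: (@Xn_dvd_of_small _ _ rho ((M * (`|x| + K)) ^+ d)) => // c c0 c1 _.
  rewrite PsiE horner2_eval -/(ev c psi).
  have [s sE] := closed_field_poly_normal (ev c psi).
  have evm : ev c psi \is monic by rewrite psiE char_poly_monic.
  move: sE; rewrite (monicP evm) scale1r => sE.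
  have ss : size s = d.
    by have := congr1 (fun p : {poly C} => size p) sE; rewrite psiE size_char_poly
      size_prod_XsubC => -[].
  have sr z : z \in s -> `|z| <= K * `|rho.[c]|.
    move=> zs; have : root (ev c psi) z by rewrite sE root_prod_XsubC.
    move=> /root_psi[t Ft ->]; rewrite /Q hornerN hornerN hornerM hornerM normrN normrM.
    rewrite -(VF _ _ Ft) normrM mulrCA mulrC ler_wpM2l // hK // gtr0_real //.
  have rhoc : `|rho.[c]| <= c ^+ r * M.
    rewrite rhoE hornerM hornerXn normrM normrX (gtr0_norm c0) ler_wpM2l ?exprn_ge0 ?(ltW c0) //.
    by rewrite hM // gtr0_norm.
  rewrite exprM -exprMn [X in _ <= X ^+ _]mulrC [X in _ <= X ^+ _]mulrA sE -ss.
  apply: norm_prod_XsubC_le => z zs; rewrite (le_trans (ler_normB _ _)) //.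
  rewrite (le_trans (lerD (lexx _) (sr z zs))) // normrM [`|rho.[c]| * _]mulrC -mulrDl mulrC.
  by rewrite ler_wpM2l // addr_ge0.
have [G GE] := inner_Xn_dvd dvdPsi.
have srX : size (rho *: 'X : {poly {poly C}}) = 2 by rewrite size_scale // size_polyX.
have sPsi : size Psi = d.+1 by rewrite size_comp_poly2.
(* The top coefficient of Psi is rho^d; dividing by y^(r d) leaves rho1^d, which is nonzero at 0.
   After reversal this is the value of the relation at the origin. *)
have GTop : (G`_d).[0] != 0.
  have PsiTop : Psi`_d = rho ^+ d.
    have := @lead_coef_comp _ psi (rho *: 'X); rewrite srX => /(_ isT).
    rewrite -/Psi lead_coefE sPsi /= => ->.
    by rewrite (monicP (char_poly_monic _)) mul1r lead_coefZ lead_coefX mulr1 spsi.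
  have -> : G`_d = rho1 ^+ d.
    apply: (@mulfI _ ('X^(r * d))); first by rewrite -size_poly_eq0 size_polyXn.
    by rewrite -coefCM -GE PsiTop rhoE exprMn exprM.
  by rewrite horner_exp expf_neq0.
have sG : (size G <= d.+1)%N.
  by rewrite -sPsi GE mul_polyC size_scale // -size_poly_eq0 size_polyXn.
have [w0 [w00 hw0]] := reverse_relation sG.
pose FX0 x := (F^`()).[x, 0]; pose FY0 x := (derivY F).[x, 0].
have [s sE] := closed_field_poly_normal (ev 0 F).
have evF0 : ev 0 F != 0 by rewrite monic_neq0 // FE char_poly_monic.
(* The factor [rho1] covers the zeros of rho other than 0. For y = 0 there is one linear factor per
   root of F(., 0) with F_x nonzero; at the other roots F_y vanishes too, by the slope bound. *)
pose w1 : {poly C} := \prod_(x <- s | FX0 x != 0) (FY0 x *: 'X + (FX0 x)%:P).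
exists (w0 * rho1%:P * w1^:P).
  rewrite !hornerM w00 !hornerC !mulf_neq0 //.
  rewrite polyC0 horner2_eval -map_poly_comp.
  rewrite (@eq_map_poly _ _ _ id) ?map_poly_id // => [|a]; last by rewrite /= /horner_eval hornerC.
  rewrite horner_prod prodf_seq_neq0; apply/allP => x _; apply/implyP => hx.
  by rewrite !hornerE.
move=> x c Fxc FY.
set a := - _; rewrite !hornerM !hornerC.
have [rho1c|rho1c] := eqVneq rho1.[c] 0; first by rewrite rho1c mulr0 mul0r.
have [c0|c0] := eqVneq c 0.
  subst c; have FX : FX0 x != 0.
    apply: contraNneq FY => h; rewrite -normr_le0.
    by rewrite (le_trans (hK x 0 (rpred0 _) Fxc)) // -/(FX0 x) h normr0 mulr0.
  suff -> : (w1^:P).[a, 0] = 0 by rewrite mulr0.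
  rewrite horner2_eval -map_poly_comp.
  rewrite (@eq_map_poly _ _ _ id) ?map_poly_id // => [|b]; last by rewrite /= /horner_eval hornerC.
  have xs : x \in s.
    by rewrite -root_prod_XsubC -(rootZ _ _ (_ : lead_coef (ev 0 F) != 0)) ?lead_coef_eq0 // -sE
      /root -horner2_eval Fxc.
  rewrite horner_prod (big_rem x) //= FX hornerD hornerZ hornerX hornerC.
  by rewrite /a mulrN mulrCA divff ?mulr1 ?addNr ?mul0r.
have rhoc : rho.[c] != 0 by rewrite rhoE hornerM hornerXn mulf_neq0 // expf_neq0.
have FXn0 : (F^`()).[x, c] != 0.
  by apply: contraNneq rhoc => h; rewrite -(VF x c Fxc) h mulr0.
have a0 : a != 0 by rewrite oppr_eq0 mulf_neq0 // invr_eq0.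
suff : G.[a^-1, c] = 0 by rewrite hw0 // => ->; rewrite mulr0 !mul0r.
have := PsiE a^-1 c; rewrite GE hornerM !hornerC hornerM hornerXn.
have -> : rho.[c] * a^-1 = Q.[x, c].
  rewrite /a invrN invf_div mulrN /Q !hornerN hornerM hornerM -(VF x c Fxc).
  by field.
rewrite psi_root // => /eqP; rewrite mulf_eq0 expf_eq0 (negPf c0) andbF /= => /eqP.
by [].
Qed.

Lemma monic_deriv_neq0 F : F \is monic -> (1 < size F)%N -> F^`() != 0.
Proof.
move=> Fm F1; apply: contraTneq (oner_neq0 C) => F'0.
have := congr1 (fun p : {poly {poly C}} => p`_(size F).-2) F'0.
rewrite coef_deriv coef0 (_ : (size F).-2.+1 = (size F).-1) => [|]; last by case: size F1 => [|[]].
rewrite -lead_coefE (monicP Fm) -[_ *+ _](rmorph_nat (@polyC C)) => /eqP.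
by rewrite polyC_eq0 pnatr_eq0; case: size F1 => [|[]].
Qed.

(** The slope condition passes to factors, so repeated factors are treated by splitting F with
    [gauss_monic] until the coprime case or F = 1 is reached. *)
Lemma hyperbolic_tangent_relation eta F : 0 < eta -> hyperbolic_slope eta F ->
  F \is monic -> tangent_relation F.
Proof.
move=> eta0; elim: {F}(size F) {-2}F (leqnn (size F)) => [|m IHm] F sF hF Fm.
  by move: sF; rewrite leqn0 size_poly_eq0 => /eqP F0; move: (monic_neq0 Fm); rewrite F0 eqxx.
have [F1|F1] := leqP (size F) 1.
  exists 1; first by rewrite !hornerC oner_neq0.
  move=> x y; rewrite (size1_polyC F1) hornerC => h.
  move: h; have := monicP Fm; rewrite {1}(size1_polyC F1) lead_coefC => ->.
  by rewrite hornerC => /eqP; rewrite oner_eq0.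
have [cop|ncop] := boolP (coprimep F F^`()); first exact: tangent_relation_coprime hF _ _ _.
have [D [H [[FE Dm Hm] [D1 H1]]]] := gauss_monic Fm F1 (monic_deriv_neq0 Fm F1) ncop.
have sDH : (size F).+1 = (size D + size H)%N.
  by rewrite FE size_Mmonic ?monic_neq0 // prednK // addn_gt0 (ltnW D1).
rewrite FE; apply: tangent_relation_mul; apply: IHm => //.
- by rewrite -ltnS (leq_trans _ sF) // -ltnS sDH -addn2 leq_add2l.
- by move=> x y /hF; rewrite FE !hornerM mulf_eq0 negb_or => /andP[].
- by rewrite -ltnS (leq_trans _ sF) // -ltnS sDH -add2n leq_add2r.
- by move=> x y /hF; rewrite FE !hornerM mulf_eq0 negb_or => /andP[].
Qed.

End TangentRelation.

(** * Multivariate polynomials, homogeneous factors and Zariski closures *)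

Section MPolyGeneral.
Variables (n : nat) (R : comNzRingType).
Implicit Types p q : {mpoly R[n]}.

Lemma mpoly_ring_ind (P : {mpoly R[n]} -> Prop) :
  (forall c, P c%:MP) -> (forall i, P 'X_i) ->
  (forall p q, P p -> P q -> P (p + q)) -> (forall p q, P p -> P q -> P (p * q)) ->
  forall p, P p.
Proof.
move=> hC hX hD hM; elim/mpolyind => [|c m p _ _ Pp]; first by rewrite -mpolyC0.
apply: (hD) => //; rewrite -mul_mpolyC; apply: (hM) => //.
rewrite mpolyXE_id; elim/big_ind: _ => // [|i _]; first by rewrite -mpolyC1.
elim: (m i) => [|k IH]; first by rewrite expr0 -mpolyC1.
by rewrite exprS; apply: (hM).
Qed.

(** Chain rule for any derivation that kills the coefficients, so as to serve both [deriv] and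
    [derivY]. *)
Lemma mmap_derivation (S : comNzRingType) (D : S -> S) (f : {rmorphism R -> S})
    (h : 'I_n -> S) p :
  {morph D : x y / x + y} -> (forall x y, D (x * y) = D x * y + x * D y) ->
  (forall c, D (f c) = 0) ->
  D (mmap f h p) = \sum_i mmap f h p^`M(i) * D (h i).
Proof.
move=> Dadd Dmul Df; elim/mpoly_ring_ind: p => [c|j|p q IHp IHq|p q IHp IHq].
- by rewrite mmapC Df big1 // => i _; rewrite mderivC mmap0 mul0r.
- rewrite (bigD1 j) //= mderivX mnm1E eqxx scale1r big1 => [|i ij].
    have -> : (U_(j) - U_(j))%MM = 0%MM :> 'X_{1..n}.
      by apply/mnmP => k; rewrite mnmBE subnn mnm0E.
    by rewrite mpolyX0 rmorph1 mul1r addr0 mmapX mmap1U.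
  by rewrite mderivX mnm1E eq_sym (negPf ij) scale0r mmap0 mul0r.
- rewrite mmapD Dadd IHp IHq -big_split; apply: eq_bigr => i _ /=.
  by rewrite mderivD mmapD mulrDl.
- rewrite rmorphM /= Dmul IHp IHq mulr_suml mulr_sumr -big_split.
  apply: eq_bigr => i _ /=; rewrite mderivM mmapD !rmorphM /=.
  by rewrite mulrDl mulrAC !mulrA.
Qed.

Lemma deriv_mmap (h : 'I_n -> {poly R}) p :
  (mmap (@polyC R) h p)^`() = \sum_i mmap (@polyC R) h p^`M(i) * (h i)^`().
Proof.
by apply: mmap_derivation => [x y|x y|c]; rewrite ?derivD ?derivM ?derivC.
Qed.

Lemma horner_mmap (h : 'I_n -> {poly R}) p t :
  (mmap (@polyC R) h p).[t] = p.@[fun i => (h i).[t]].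
Proof.
elim/mpoly_ring_ind: p => [c|i|p q IHp IHq|p q IHp IHq].
- by rewrite mmapC mevalC hornerC.
- by rewrite mmapX mmap1U mevalXU.
- by rewrite mmapD hornerD mevalD IHp IHq.
- by rewrite rmorphM hornerM mevalM IHp IHq.
Qed.

Lemma dhomog_meval d p (t : R) v : p \is d.-homog ->
  p.@[fun i => t * v i] = t ^+ d * p.@[v].
Proof.
move=> /dhomogP pd; rewrite !mevalE mulr_sumr; apply: eq_big_seq => m /pd dm.
rewrite [RHS]mulrCA -dm /= mdegE; congr (_ * _); rewrite -prodrXr -big_split /=.
by apply: eq_bigr => i _; rewrite exprMn.
Qed.

Definition mline p (v u : 'I_n -> R) : {poly R} :=
  mmap (@polyC R) (fun i => (v i)%:P + u i *: 'X) p.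

Lemma horner_mline p v u t : (mline p v u).[t] = p.@[fun i => v i + t * u i].
Proof.
by rewrite horner_mmap; apply: meval_eq => i; rewrite !hornerE [_ * t]mulrC.
Qed.

Lemma deriv_mline p v u : (mline p v u)^`() = \sum_i u i *: mline p^`M(i) v u.
Proof.
rewrite deriv_mmap; apply: eq_bigr => i _.
by rewrite derivD derivC derivZ derivX add0r -mulrC -scalerAl mul1r.
Qed.

End MPolyGeneral.

Section MPolyEval.
Variables (n : nat) (R : numDomainType).
Implicit Types p q : {mpoly R[n]}.

Lemma poly_nat_eq0 (q : {poly R}) : (forall k : nat, q.[k%:R] = 0) -> q = 0.
Proof.
move=> hq; apply/eqP; apply: contraT => q0.
have := @max_poly_roots _ q [seq k%:R | k <- iota 0 (size q)] q0.
rewrite size_map size_iota ltnn; apply.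
  by apply/allP => _ /mapP[k _ ->]; apply/rootP.
rewrite map_inj_uniq ?iota_uniq // => i j /eqP.
by rewrite eqr_nat => /eqP.
Qed.

(** Vanishing on the natural grid passes to the partial derivatives, since the restriction to a line
    parallel to an axis has all naturals as roots. In characteristic 0, a polynomial whose partial
    derivatives are all zero is constant. *)
Lemma meval_nat_eq0 p :
  (forall v : 'I_n -> nat, p.@[fun i => (v i)%:R] = 0) -> p = 0.
Proof.
elim: {p}(msize p) {-2}p (leqnn (msize p)) => [|k IHk] p sp hp.
  by apply/eqP; rewrite -msize_poly_eq0 -leqn0.
have dp i : p^`M(i) = 0.
  apply: IHk => [|v].
    rewrite msizeE; apply/bigmax_leqP_seq => m; rewrite mcoeff_msupp mcoeff_deriv => h _.
    have mp : (m + U_(i))%MM \in msupp p.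
      by rewrite mcoeff_msupp; apply: contraNneq h => ->; rewrite mul0rn.
    by have := msize_mdeg_lt mp; rewrite mdegD mdeg1 addn1 => /leq_trans/(_ sp).
  pose u (j : 'I_n) : R := (j == i)%:R.
  have := deriv_mline p (fun i => (v i)%:R) u.
  have -> : mline p (fun i => (v i)%:R) u = 0.
    apply: poly_nat_eq0 => t; rewrite horner_mline -(hp (fun j => v j + t * (j == i))%N).
    by apply: meval_eq => j; rewrite natrD natrM.
  rewrite derivC => /(congr1 (fun q : {poly R} => q.[0])); rewrite horner0 horner_sum (bigD1 i) //=.
  rewrite hornerZ /u eqxx mul1r big1 => [|j ji]; last first.
    by rewrite (negPf ji) scale0r horner0.
  rewrite addr0 horner_mline => h; rewrite [RHS]h; apply: meval_eq => j.
  by rewrite mul0r addr0.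
have pC : p = (p@_0%MM)%:MP.
  apply/mpolyP => m; rewrite mcoeffC.
  have [->|m0] := eqVneq m 0%MM; first by rewrite mulr1.
  rewrite mulr0.
  have [i mi] : exists i, m i != 0%N.
    apply/existsP; apply: contraNT m0; rewrite negb_exists => /forallP h.
    by apply/eqP/mnmP => i; rewrite mnm0E; apply/eqP; have := h i; rewrite negbK.
  have := mcoeff_deriv i (m - U_(i))%MM p.
  rewrite dp mcoeff0 submK ?lep1mP // => /esym/eqP; rewrite mulrn_eq0 /= => /eqP.
  by [].
have := hp (fun=> 0%N); by rewrite pC mevalC => ->; rewrite mpolyC0.
Qed.

End MPolyEval.

Section HomogeneousFactors.
Variables (n : nat) (R : idomainType).
Implicit Types f g p : {mpoly R[n]}.

(** The substitution X_i -> X_i T, whose coefficient at T^k is the homogeneous component of degree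
    k. Being multiplicative, it turns factors of a form into factors of a monomial in T. *)
Definition mgrading p : {poly {mpoly R[n]}} :=
  mmap (polyC \o @mpolyC n R) (fun i => 'X_i *: 'X) p.

Lemma mgradingE p : mgrading p = \sum_(m <- msupp p) (p@_m *: 'X_[m]) *: 'X^(mdeg m).
Proof.
apply: eq_bigr => m _; rewrite /= mul_polyC /mmap1.
rewrite (eq_bigr (fun i => ('X_i ^+ m i) *: 'X^(m i))) => [|i _]; last by rewrite exprZn.
by rewrite scaler_prod -mpolyXE_id prodrXr -mdegE scalerA mul_mpolyC.
Qed.

Lemma mgradingM : {morph mgrading : p q / p * q}.
Proof. by move=> p q; rewrite /mgrading rmorphM. Qed.

Lemma mgrading1 p : (mgrading p).[1] = p.
Proof.
rewrite mgradingE horner_sum [RHS]mpolyE; apply: eq_bigr => m _.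
by rewrite hornerZ hornerXn expr1n mulr1.
Qed.

Lemma mgrading_homog p k : (mgrading p)`_k \is k.-homog.
Proof.
rewrite mgradingE coef_sum rpred_sum // => m _; rewrite coefZ coefXn.
have [->|_] := eqVneq; last by rewrite mulr0 rpred0.
by rewrite mulr1 rpredZ // dhomogX.
Qed.

Lemma mgrading_dhomog d p : p \is d.-homog -> mgrading p = p *: 'X^d.
Proof.
move=> /dhomogP pd; rewrite mgradingE [in RHS](mpolyE p) scaler_suml.
by apply: eq_big_seq => m /pd <-.
Qed.

(** Strip u and v of their powers of the variable: the cofactors have nonzero constant terms, so
    comparing orders at 0 shows that their product is constant. *)
Lemma poly_monomial_factor (D : idomainType) (u v : {poly D}) (a : D) d :
  a != 0 -> u * v = a *: 'X^d -> exists c k, u = c *: 'X^k.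
Proof.
move=> a0 uv.
have uv0 : u * v != 0 by rewrite uv -mul_polyC mulf_neq0 ?polyC_eq0 // -size_poly_eq0 size_polyXn.
move: (uv0); rewrite mulf_eq0 negb_or => /andP[u0 v0].
have [i [u1 hu uE]] := multiplicity_XsubC u 0.
have [j [v1 hv vE]] := multiplicity_XsubC v 0.
rewrite subr0 in uE vE; rewrite u0 /= in hu; rewrite v0 /= in hv.
have u1v1 : (u1 * v1) * 'X^(i + j) = a%:P * 'X^d.
  by rewrite mul_polyC -uv uE vE exprD mulrACA.
have ne : (u1 * v1).[0] != 0 by rewrite hornerM mulf_neq0.
have dE : d = (i + j)%N.
  apply/eqP; rewrite eqn_leq; apply/andP; split; rewrite leqNgt; apply/negP => lt.
    have := congr1 (fun p : {poly D} => p`_(i + j)) u1v1.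
    rewrite /= !coefMXn lt ltnn subnn -horner_coef0 => /eqP.
    by rewrite (negPf ne).
  have := congr1 (fun p : {poly D} => p`_d) u1v1.
  by rewrite /= !coefMXn lt ltnn subnn coefC eqxx => /eqP; rewrite eq_sym (negPf a0).
have {}u1v1 : u1 * v1 = a%:P.
  apply: (@mulIf _ 'X^d); first by rewrite -size_poly_eq0 size_polyXn.
  by rewrite -u1v1 dE.
have u10 : u1 != 0 by apply: contraNneq ne => ->; rewrite mul0r horner0.
have v10 : v1 != 0 by apply: contraNneq ne => ->; rewrite mulr0 horner0.
have s1 : (size u1 <= 1)%N.
  have := congr1 (fun p : {poly D} => size p) u1v1; rewrite size_polyC a0 size_mul //.
  move: u10 v10; rewrite -!size_poly_gt0; case: (size u1) => // [[//|a']] _.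
  by case: (size v1) => // b' _; rewrite addnS.
by exists u1`_0, i; rewrite uE {1}(size1_polyC s1) mul_polyC.
Qed.

Lemma dhomog_factor d p g f : p != 0 -> p \is d.-homog -> p = g * f ->
  exists e, f \is e.-homog.
Proof.
move=> p0 pd pgf.
have := mgradingM f g; rewrite mulrC -pgf (mgrading_dhomog pd) => /esym.
move=> /(poly_monomial_factor p0)[c [k fE]]; exists k.
have fc : f = c by rewrite -[f]mgrading1 fE hornerZ hornerXn expr1n mulr1.
by have := mgrading_homog f k; rewrite fE coefZ coefXn eqxx mulr1 -fc.
Qed.

Lemma mderiv_homog d f i : f \is d.-homog -> f^`M(i) \is d.-1.-homog.
Proof.
move=> /dhomogP fd; apply/dhomogP => m; rewrite mcoeff_msupp mcoeff_deriv => h.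
have /fd/= : (m + U_(i))%MM \in msupp f.
  by rewrite mcoeff_msupp; apply: contraNneq h => ->; rewrite mul0rn.
by rewrite mdegD mdeg1 addn1 => <-.
Qed.

End HomogeneousFactors.

Lemma euler_identity n (R : numDomainType) (f : {mpoly R[n]}) d v :
  f \is d.-homog -> \sum_i v i * (f^`M(i)).@[v] = d%:R * f.@[v].
Proof.
move=> fd.
have lE : mline f (fun=> 0) v = f.@[v] *: 'X^d.
  apply/eqP; rewrite -subr_eq0; apply/eqP/poly_nat_eq0 => k.
  rewrite hornerD hornerN horner_mline hornerZ hornerXn mulrC -(dhomog_meval _ _ fd).
  by apply/eqP; rewrite subr_eq0; apply/eqP/meval_eq => i; rewrite add0r.
have := deriv_mline f (fun=> 0) v; rewrite lE derivZ derivXn.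
move=> /(congr1 (fun q : {poly R} => q.[1])).
rewrite hornerZ hornerMn hornerXn expr1n mulrC => ->.
rewrite horner_sum; apply: eq_bigr => i _; rewrite hornerZ horner_mline.
by congr (_ * _); apply: meval_eq => j; rewrite mul1r add0r.
Qed.

Section ZariskiClosure.
Variable F : numFieldType.
Local Open Scope classical_set_scope.

(** Closed sets are cut out by homogeneous polynomials, while g is arbitrary. Vanishing on all
    nonzero multiples of y forces every homogeneous component of g to vanish at y. *)
Lemma zariski_closure_meval (S : set 'rV[F]_3) (g : {mpoly F[3]}) x :
  (forall y, S y -> y != 0 /\ forall t, t != 0 -> g.@[fun i => t * y 0 i] = 0) ->
  zariski_closure S x -> g.@[x 0] = 0.
Proof.
move=> Sg Sx.
pose G : set {mpoly F[3]} := [set h | exists k : nat, h = pihomog [measure of mdeg] k g].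
have [_ hx] : proj_zeros G x.
  apply: Sx; split; first by exists G; split=> // h [k ->]; exists k; exact: pihomogP.
  move=> y /Sg[y0 gy]; split=> // h [k ->].
  have gE := pihomog_partitionE (leq_maxl (msize g) k.+1).
  set N := maxn _ _ in gE.
  pose q := \poly_(d < N) (pihomog [measure of mdeg] d g).@[y 0].
  (* The extra factor covers t = 0, where nothing is assumed. *)
  have q0 : q * 'X = 0.
    apply: poly_nat_eq0 => t; rewrite hornerMX.
    have [->|t0] := eqVneq t%:R (0 : F); first by rewrite mulr0.
    rewrite -[RHS](mul0r t%:R) -(gy _ t0) [in RHS]gE raddf_sum horner_poly; congr (_ * _).
    by apply: eq_bigr => d _; rewrite mulrC /= -(dhomog_meval _ _ (pihomogP _ _ _)).
  have := congr1 (fun p : {poly F} => p`_k.+1) q0.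
  by rewrite /= coefMX coef0 coef_poly leq_maxr.
rewrite (pihomog_partitionE (leqnn (msize g))) raddf_sum big1 //= => d _.
by apply: hx; exists d.
Qed.

End ZariskiClosure.

Section PolynomialFunctions.
Variables (N : nat) (R : comNzRingType).
Implicit Types f g : 'rV[R]_N -> R.

(** Polynomiality as a property of functions: determinants and adjugates can then be written with
    scalar matrices instead of matrices over a polynomial ring. *)
Definition polyfun f := exists p : {mpoly R[N]}, forall x, f x = p.@[x 0].

Lemma polyfun_ext f g : f =1 g -> polyfun f -> polyfun g.
Proof. by move=> fg [p fp]; exists p => x; rewrite -fg. Qed.

Lemma polyfun_const c : polyfun (fun=> c).
Proof. by exists c%:MP => x; rewrite mevalC. Qed.

Lemma polyfun_coord i : polyfun (fun x => x 0 i).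
Proof. by exists 'X_i => x; rewrite mevalXU. Qed.

Lemma polyfunD f g : polyfun f -> polyfun g -> polyfun (fun x => f x + g x).
Proof. by move=> [p fp] [q gq]; exists (p + q) => x; rewrite mevalD fp gq. Qed.

Lemma polyfunM f g : polyfun f -> polyfun g -> polyfun (fun x => f x * g x).
Proof. by move=> [p fp] [q gq]; exists (p * q) => x; rewrite mevalM fp gq. Qed.

Lemma polyfunN f : polyfun f -> polyfun (fun x => - f x).
Proof. by move=> [p fp]; exists (- p) => x; rewrite mevalN fp. Qed.

Lemma polyfunX k f : polyfun f -> polyfun (fun x => f x ^+ k).
Proof. by move=> [p fp]; exists (p ^+ k) => x; rewrite rmorphXn /= fp. Qed.

Lemma polyfun_sum (I : Type) (r : seq I) (P : pred I) (F : I -> 'rV[R]_N -> R) :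
  (forall i, P i -> polyfun (F i)) -> polyfun (fun x => \sum_(i <- r | P i) F i x).
Proof.
move=> hF; elim: r => [|i r IHr].
  by apply: polyfun_ext (polyfun_const 0) => x; rewrite big_nil.
have [Pi|nPi] := boolP (P i).
  by apply: polyfun_ext (polyfunD (hF i Pi) IHr) => x; rewrite big_cons Pi.
by apply: polyfun_ext IHr => x; rewrite big_cons (negPf nPi).
Qed.

Lemma polyfun_prod (I : Type) (r : seq I) (P : pred I) (F : I -> 'rV[R]_N -> R) :
  (forall i, P i -> polyfun (F i)) -> polyfun (fun x => \prod_(i <- r | P i) F i x).
Proof.
move=> hF; elim: r => [|i r IHr].
  by apply: polyfun_ext (polyfun_const 1) => x; rewrite big_nil.
have [Pi|nPi] := boolP (P i).
  by apply: polyfun_ext (polyfunM (hF i Pi) IHr) => x; rewrite big_cons Pi.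
by apply: polyfun_ext IHr => x; rewrite big_cons (negPf nPi).
Qed.

Definition mxpolyfun m n (M : 'rV[R]_N -> 'M[R]_(m, n)) :=
  forall i j, polyfun (fun x => M x i j).

Lemma polyfun_det n (M : 'rV[R]_N -> 'M[R]_n) :
  mxpolyfun M -> polyfun (fun x => \det (M x)).
Proof.
move=> hM; apply: polyfun_sum => s _; apply: polyfunM; first exact: polyfun_const.
by apply: polyfun_prod => i _.
Qed.

Lemma mxpolyfun_const m n (A : 'M[R]_(m, n)) : mxpolyfun (fun=> A).
Proof. by move=> i j; exact: polyfun_const. Qed.

Lemma mxpolyfunD m n (M M' : 'rV[R]_N -> 'M[R]_(m, n)) :
  mxpolyfun M -> mxpolyfun M' -> mxpolyfun (fun x => M x + M' x).
Proof.
by move=> h h' i j; apply: polyfun_ext (polyfunD (h i j) (h' i j)) => x; rewrite mxE.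
Qed.

Lemma mxpolyfunN m n (M : 'rV[R]_N -> 'M[R]_(m, n)) :
  mxpolyfun M -> mxpolyfun (fun x => - M x).
Proof. by move=> h i j; apply: polyfun_ext (polyfunN (h i j)) => x; rewrite mxE. Qed.

Lemma mxpolyfunZ m n f (M : 'rV[R]_N -> 'M[R]_(m, n)) :
  polyfun f -> mxpolyfun M -> mxpolyfun (fun x => f x *: M x).
Proof. by move=> hf h i j; apply: polyfun_ext (polyfunM hf (h i j)) => x; rewrite mxE. Qed.

Lemma mxpolyfunM m n k (M : 'rV[R]_N -> 'M[R]_(m, n)) (M' : 'rV[R]_N -> 'M[R]_(n, k)) :
  mxpolyfun M -> mxpolyfun M' -> mxpolyfun (fun x => M x *m M' x).
Proof.
move=> h h' i j; apply: (@polyfun_ext (fun x => \sum_l M x i l * M' x l j)).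
  by move=> x; rewrite mxE.
by apply: polyfun_sum => l _; apply: polyfunM.
Qed.

Lemma mxpolyfun_exp n k (M : 'rV[R]_N -> 'M[R]_n) :
  mxpolyfun M -> mxpolyfun (fun x => M x ^+ k).
Proof.
move=> h; elim: k => [|k IH]; first exact: mxpolyfun_const.
move=> i j; apply: polyfun_ext (mxpolyfunM h IH i j) => x; by rewrite exprS.
Qed.

Lemma mxpolyfun_scalar n f : polyfun f -> mxpolyfun (fun x => (f x)%:M : 'M_n).
Proof.
move=> hf i j; case: (eqVneq i j) => [->|ij].
  by apply: polyfun_ext hf => x; rewrite mxE eqxx.
by apply: polyfun_ext (polyfun_const 0) => x; rewrite mxE (negPf ij).
Qed.

Lemma mxpolyfun_adj n (M : 'rV[R]_N -> 'M[R]_n) :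
  mxpolyfun M -> mxpolyfun (fun x => \adj (M x)).
Proof.
move=> h i j; apply: (@polyfun_ext (fun x => cofactor (M x) j i)).
  by move=> x; rewrite mxE.
apply: polyfunM; first exact: polyfun_const.
apply: polyfun_det => k l.
apply: polyfun_ext (h (lift j k) (lift i l)) => x; by rewrite !mxE.
Qed.

Lemma mxpolyfun_sum m n (I : Type) (r : seq I) (P : pred I)
    (F : I -> 'rV[R]_N -> 'M[R]_(m, n)) :
  (forall i, P i -> mxpolyfun (F i)) -> mxpolyfun (fun x => \sum_(i <- r | P i) F i x).
Proof.
move=> hF k l; apply: (@polyfun_ext (fun x => \sum_(i <- r | P i) F i x k l)).
  by move=> x; rewrite summxE.
by apply: polyfun_sum => i Pi; apply: hF.
Qed.

End PolynomialFunctions.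

(** * The determinantal pencil in a frame *)

Section Frame.
Variables (C : numClosedFieldType) (e v w : 'I_3 -> C).
Implicit Types f p : {mpoly C[3]}.

Definition frame_coord (i : 'I_3) : {poly {poly C}} :=
  (e i)%:P *: 'X + ((v i)%:P + w i *: 'X)%:P.

(* [f] in the coordinates [(x, 1, y)] of the frame [(e, v, w)]. *)
Definition in_frame f : {poly {poly C}} := mmap (polyC \o polyC) frame_coord f.

Definition frame_point (x y : C) : 'I_3 -> C := fun i => x * e i + v i + y * w i.

Lemma horner_frame_coord i x y : (frame_coord i).[x, y] = frame_point x y i.
Proof.
by rewrite /frame_coord !hornerD !hornerZ !hornerX !hornerC hornerM !hornerD !hornerZ
  !hornerX !hornerC /frame_point; ring.
Qed.

Lemma horner_in_frame f x y : (in_frame f).[x, y] = f.@[frame_point x y].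
Proof.
rewrite /in_frame; elim/mpoly_ring_ind: f => [c|i|p q IHp IHq|p q IHp IHq].
- by rewrite mmapC mevalC /= !hornerC.
- by rewrite mmapX mmap1U mevalXU horner_frame_coord.
- by rewrite mmapD !hornerD mevalD IHp IHq.
- by rewrite rmorphM !hornerM mevalM IHp IHq.
Qed.

Lemma horner_in_frame_derivX f x y :
  (in_frame f)^`().[x, y] = \sum_i e i * f^`M(i).@[frame_point x y].
Proof.
rewrite /in_frame (@mmap_derivation _ _ _ (@deriv _)); first last.
- by move=> c /=; rewrite derivC.
- exact: derivM.
- exact: derivD.
rewrite !horner_sum; apply: eq_bigr => i _.
rewrite !hornerM -/(in_frame _) horner_in_frame mulrC; congr (_ * _).
by rewrite derivD derivC addr0 derivZ derivX hornerZ hornerC mulr1 hornerC.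
Qed.

Lemma horner_in_frame_derivY f x y :
  (derivY (in_frame f)).[x, y] = \sum_i w i * f^`M(i).@[frame_point x y].
Proof.
rewrite /in_frame (@mmap_derivation _ _ _ (@derivY _)); first last.
- by move=> c /=; rewrite /derivY swapXY_polyC map_polyC derivC raddf0.
- exact: derivYM.
- by move=> p q; rewrite /derivY rmorphD /= derivD rmorphD.
rewrite !horner_sum; apply: eq_bigr => i _.
rewrite !hornerM -/(in_frame _) horner_in_frame mulrC; congr (_ * _).
rewrite horner_derivY /frame_coord hornerD hornerZ hornerX hornerC -polyCM derivD derivC add0r.
by rewrite derivD derivC derivZ derivX add0r hornerZ hornerC mulr1.
Qed.

Lemma in_frameM : {morph in_frame : p q / p * q}.
Proof. by move=> p q; rewrite /in_frame rmorphM. Qed.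

End Frame.

Section Pencil.
Variables (C : numClosedFieldType) (n : nat) (A : 'M[C]_n).

Definition pencil (y : 'I_3 -> C) : 'M[C]_n :=
  y 0 *: pencil_coef0 C n + y 1 *: pencil_coef1 A + y 2%:R *: pencil_coef2 A.

Lemma pencil_formE y : (pencil_form A).@[y] = \det (pencil y).
Proof.
rewrite /pencil_form -det_map_mx; congr (\det _); apply/matrixP => i j.
by rewrite !mxE !rmorphD !rmorphM /= !mevalXU !mevalC.
Qed.

Lemma in_frame_pencil e v w :
  in_frame e v w (pencil_form A) =
  \det ('X *: map_mx (polyC \o polyC) (pencil e) +
        map_mx polyC (map_mx polyC (pencil v) + 'X *: map_mx polyC (pencil w))).
Proof.
rewrite /in_frame /pencil_form -det_map_mx; congr (\det _); apply/matrixP => i j.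
rewrite !mxE !rmorphD !rmorphM /= !mmapX !mmap1U !mmapC /frame_coord /=.
rewrite -!mul_polyC !(rmorphD, rmorphM) /=.
ring.
Qed.

(** Factoring out the pencil at e leaves a characteristic matrix, whose determinant is monic. *)
Lemma in_frame_pencil_lead e v w : pencil e \in unitmx ->
  lead_coef (in_frame e v w (pencil_form A)) = (\det (pencil e))%:P.
Proof.
move=> He; rewrite in_frame_pencil; set N := _ + _ *: map_mx _ (pencil w).
pose B := - (map_mx polyC (invmx (pencil e)) *m N).
have -> : 'X *: map_mx (polyC \o polyC) (pencil e) + map_mx polyC N =
    map_mx polyC (map_mx polyC (pencil e)) *m char_poly_mx B.
  rewrite /char_poly_mx mulmxBr mul_mx_scalar map_mx_comp; congr (_ + _).
  rewrite -mulmxN -map_mxN /B opprK -map_mxM mulmxA -map_mxM mulmxV // map_mx1 mul1mx.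
  by [].
rewrite det_mulmx -/(char_poly B) !det_map_mx /= lead_coefM lead_coefC.
by rewrite (monicP (char_poly_monic B)) mulr1.
Qed.

End Pencil.

Section QuadraticForm.
Variables (C : numClosedFieldType) (n : nat).
Implicit Types (A B : 'M[C]_n) (u : 'cV[C]_n).

Definition qform B u : C := (u^t* *m B *m u) 0 0.

Lemma qformD A B u : qform (A + B) u = qform A u + qform B u.
Proof. by rewrite /qform mulmxDr mulmxDl mxE. Qed.

Lemma qformZ c B u : qform (c *: B) u = c * qform B u.
Proof. by rewrite /qform -scalemxAr -scalemxAl mxE. Qed.

Lemma qform_ker B u : B *m u = 0 -> qform B u = 0.
Proof. by move=> Bu; rewrite /qform -mulmxA Bu mulmx0 mxE. Qed.

Lemma qform1 u : qform 1%:M u = \sum_i `|u i 0| ^+ 2.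
Proof.
rewrite /qform mulmx1 mxE; apply: eq_bigr => i _.
by rewrite !mxE normCK mulrC.
Qed.

Lemma qform1_gt0 u : u != 0 -> 0 < qform 1%:M u.
Proof.
move=> u0; rewrite qform1.
have [i ui] : exists i, u i 0 != 0.
  apply/existsP; apply: contraNT u0; rewrite negb_exists => /forallP h.
  by apply/eqP/colP => i; rewrite mxE; apply/eqP; have := h i; rewrite negbK.
rewrite (bigD1 i) //= ltr_pwDl ?exprn_gt0 ?normr_gt0 //.
by apply: sumr_ge0 => j _; rewrite exprn_ge0.
Qed.

Lemma det0_kernel (B : 'M[C]_n) : \det B = 0 -> exists2 u : 'cV_n, u != 0 & B *m u = 0.
Proof.
rewrite -det_tr => /eqP/det0P[u u0 uB]; exists u^T; first by rewrite trmx_eq0.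
by rewrite -[B]trmxK -trmx_mul uB trmx0.
Qed.

Lemma kernel_det0 (B : 'M[C]_n) (u : 'cV_n) : u != 0 -> B *m u = 0 -> \det B = 0.
Proof.
move=> u0 Bu; apply/eqP; rewrite -det_tr; apply/det0P; exists u^T; first by rewrite trmx_eq0.
by rewrite -trmx_mul Bu trmx0.
Qed.

End QuadraticForm.

Section FrameTangentRelation.
Variables (C : numClosedFieldType) (n : nat) (A : 'M[C]_n) (eta : C).
Variables (e v : 'I_3 -> C).
Hypothesis eta_gt0 : 0 < eta.
Hypothesis e_definite : forall u, eta * qform 1%:M u <= qform (pencil A e) u.
Hypothesis v_hermitian : forall u, qform (pencil A v) u \is Num.real.

Let w (i : 'I_3) : C := (i == 0)%:R.
Let H := pencil A e.
Let K := pencil A v.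

Lemma pencil_w : pencil A w = 1%:M.
Proof. by rewrite /pencil /w /= scale1r !scale0r !addr0. Qed.

Lemma pencil_frame_point x y : pencil A (frame_point e v w x y) = x *: H + K + y%:M.
Proof.
rewrite -[y%:M]scalemx1 -pencil_w /H /K /pencil /frame_point.
move: (pencil_coef0 C n) (pencil_coef1 A) (pencil_coef2 A) => B0 B1 B2.
by apply/matrixP => i j; rewrite !mxE; ring.
Qed.

Lemma definite_unit : H \in unitmx.
Proof.
rewrite unitmxE unitfE; apply/eqP => /det0_kernel[u u0 Hu].
have := e_definite u; rewrite -/H (qform_ker Hu).
by move=> h; have := lt_le_trans (mulr_gt0 eta_gt0 (qform1_gt0 u0)) h; rewrite ltxx.
Qed.

(** A zero (x, y) gives a kernel vector u of x H + K + y. The imaginary part of the form at u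
    relates Im x times the value of H to Im y times the squared norm of u, and H >= eta. *)
Lemma frame_hyperbolic f : mdivides f (pencil_form A) ->
  hyperbolic_slope eta (in_frame e v w f).
Proof.
move=> [g pE] x y yx; apply: contraTneq yx => Fxy.
have : (in_frame e v w (pencil_form A)).[x, y] = 0.
  by rewrite pE in_frameM !hornerM Fxy mulr0.
rewrite horner_in_frame pencil_formE pencil_frame_point => /det0_kernel[u u0 /qform_ker].
rewrite -scalemx1 qformD (qformD _ K) !(qformZ _ H) qformZ => /(congr1 (@Im C)).
have u10 := qform1_gt0 u0.
have H0 : 0 <= qform H u.
  by rewrite (le_trans _ (e_definite u)) // mulr_ge0 // ltW.
rewrite !raddfD /= raddf0 (Creal_ImP _ (v_hermitian u)) addr0.
rewrite ImMr ?ger0_real // ImMr ?gtr0_real // => /eqP; rewrite addr_eq0 => /eqP hI.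
have : `|'Im x| * qform H u = `|'Im y| * qform 1%:M u.
  by have := congr1 Num.norm hI; rewrite normrN !normrM (gtr0_norm u10) (ger0_norm H0).
move=> h; apply/negP => lt.
have : `|'Im x| * qform H u < `|'Im x| * qform H u.
  rewrite {1}h (lt_le_trans (_ : _ < eta * `|'Im x| * qform 1%:M u)) ?ltr_pM2r //.
  by rewrite [eta * _]mulrC -mulrA ler_wpM2l // e_definite.
by rewrite ltxx.
Qed.

Lemma frame_tangent_relation f : mdivides f (pencil_form A) ->
  exists2 r : {poly {poly C}}, r.[0, 0] != 0 &
    forall x y, f.@[frame_point e v w x y] = 0 ->
      \sum_i w i * f^`M(i).@[frame_point e v w x y] != 0 ->
      r.[- ((\sum_i e i * f^`M(i).@[frame_point e v w x y]) /
            (\sum_i w i * f^`M(i).@[frame_point e v w x y])), y] = 0.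
Proof.
move=> fp; have hyp := frame_hyperbolic fp; case: (fp) => g pE.
have := in_frame_pencil_lead v w definite_unit; rewrite pE in_frameM lead_coefM => lE.
have dH : \det H != 0 by have := definite_unit; rewrite unitmxE unitfE.
set F := in_frame e v w f in hyp lE.
(* The leading coefficient of F divides that of the pencil form, a nonzero constant; so F can be
   made monic by a scalar. *)
have [k k0 kE] : exists2 k, k != 0 & lead_coef F = k%:P.
  apply/size_poly1P; have := congr1 (fun p : {poly C} => size p) lE.
  have l0 : lead_coef (in_frame e v w g) * lead_coef F != 0 by rewrite lE polyC_eq0.
  move: (l0); rewrite mulf_eq0 negb_or => /andP[a0 b0].
  rewrite size_polyC dH size_mul //; move: a0 b0; rewrite -!size_poly_gt0.
  case: (size (lead_coef (in_frame _ _ _ g))) => // a _.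
  by case: (size (lead_coef F)) => // [[//|b]] _; rewrite addSn addnS /= addnS.
have Fm : k^-1%:P *: F \is monic.
  by rewrite monicE lead_coefZ kE -polyCM mulVf.
have hypF : hyperbolic_slope eta (k^-1%:P *: F).
  move=> x y /hyp; rewrite hornerZ hornerM hornerC => h; rewrite mulf_neq0 ?invr_eq0 //.
have [r r0 hr] := hyperbolic_tangent_relation eta_gt0 hypF Fm.
exists r => // x y fxy Y0.
have := hr x y; rewrite derivYZ derivZ !hornerZ !hornerM !hornerC.
rewrite horner_in_frame fxy mulr0 horner_in_frame_derivY horner_in_frame_derivX.
rewrite -mulf_div divff ?invr_eq0 // mul1r; apply=> //.
by rewrite mulf_neq0 ?invr_eq0.
Qed.

End FrameTangentRelation.

(** * Exclusion of points orthogonal to a definite direction *)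

Section DualAvoidsDefiniteLines.
Variables (C : numClosedFieldType) (n : nat) (A : 'M[C]_n) (eta : C).
Variables (e v : 'I_3 -> C).
Hypothesis eta_gt0 : 0 < eta.
Hypothesis e_definite : forall u, eta * qform 1%:M u <= qform (pencil A e) u.
Hypothesis v_hermitian : forall u, qform (pencil A v) u \is Num.real.
Let w (i : 'I_3) : C := (i == 0)%:R.
Hypothesis frame_basis : forall y : 'I_3 -> C,
  exists x b c, forall i, y i = x * e i + b * v i + c * w i.
Let H := pencil A e.
Let K := pencil A v.

Lemma horner2_coef (r : {poly {poly C}}) N a c :
  (size r <= N)%N -> (sizeY r <= N)%N ->
  r.[a, c] = \sum_(k < N) \sum_(l < N) r`_k`_l * a ^+ k * c ^+ l.
Proof.
move=> rN rYN; rewrite (horner_coef_wide _ rN) horner_sum; apply: eq_bigr => k _.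
rewrite hornerM -rmorphXn /= hornerC (horner_coef_wide _ (leq_trans (max_size_coefXY _ _) rYN)).
by rewrite mulr_suml; apply: eq_bigr => l _; rewrite mulrAC.
Qed.

Lemma horner2_homog (r : {poly {poly C}}) N a b d c : b != 0 ->
  (size r <= N)%N -> (sizeY r <= N)%N ->
  b ^+ N * d ^+ N * r.[- (a / b), c] =
  \sum_(k < N) \sum_(l < N) r`_k`_l * (- a) ^+ k * b ^+ (N - k) * d ^+ (N - l) * (d * c) ^+ l.
Proof.
move=> b0 rN rYN; rewrite (horner2_coef _ _ rN rYN) mulr_sumr; apply: eq_bigr => k _.
rewrite mulr_sumr; apply: eq_bigr => l _.
rewrite [(d * c) ^+ l]exprMn -mulNr exprMn exprVn.
have -> : b ^+ N = b ^+ (N - k) * b ^+ k by rewrite -exprD subnK // ltnW.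
have -> : d ^+ N = d ^+ (N - l) * d ^+ l by rewrite -exprD subnK // ltnW.
have := expf_neq0 k b0.
move: (b ^+ k) (b ^+ _) (d ^+ (N - l)) (d ^+ l) (c ^+ l) ((- a) ^+ k) => x1 x2 x3 x4 x5 x6 x10.
by field.
Qed.

(** Elimination of c. Multiplication by the adjugate of d B - a then exhibits t, times a
    determinant, as an eigenvalue. *)
Lemma pencil_kernel_shift (B D : 'M[C]_n) (u : 'cV_n) t c a b d :
  (t *: B + D + c%:M) *m u = 0 -> a * t + b + d * c = 0 ->
  t *: ((d *: B - a%:M) *m u) = - ((d *: D - b%:M) *m u).
Proof.
move=> Mu lin; have : d *: ((t *: B + D + c%:M) *m u) = 0 by rewrite Mu scaler0.
rewrite !mulmxDl !mulNmx !mul_scalar_mx -!scalemxAl.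
move: (B *m u) (D *m u) => p q h; apply/eqP; rewrite -subr_eq0; apply/eqP; rewrite -[RHS]h.
have -> : b = - (a * t) - d * c by apply/eqP; rewrite -subr_eq0 -lin; apply/eqP; ring.
by apply/matrixP => i j; rewrite !mxE; ring.
Qed.

Section DualForm.
Variables (r : {poly {poly C}}) (N : nat).
Implicit Type x : 'rV[C]_3.

(* When (t H + K + c) u = 0 and xi0 t + xi1 + xi2 c = 0, u is an eigenvector of
   Gam x for xi2 det(X) c.  So E x acts on u as r(- xi0 / xi2, c), up to the
   powers of xi2 and det(X) which clear denominators. *)
Let xi0 x := \sum_i e i * x 0 i.
Let xi1 x := \sum_i v i * x 0 i.
Let xi2 x := \sum_i w i * x 0 i.
Let X x := xi2 x *: H - (xi0 x)%:M.
Let Z x := - (\adj (X x) *m (xi2 x *: K - (xi1 x)%:M)).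
Let Gam x := - (xi0 x *: Z x + (xi1 x * \det (X x))%:M).
Let E x := \sum_(k < N) \sum_(l < N)
  (r`_k`_l * (- xi0 x) ^+ k * xi2 x ^+ (N - k) * (xi2 x * \det (X x)) ^+ (N - l)) *: Gam x ^+ l.

(** The factor [xi2] takes care of tangents where the ratio xi0 / xi2 is undefined, and det(X) of
    those at points with no component along v, which the chart of the frame misses. *)
Definition dual_form x := xi2 x * \det (X x) * \det (E x).

Lemma polyfun_dual_form : polyfun dual_form.
Proof.
have lin (a : 'I_3 -> C) : polyfun (fun x : 'rV[C]_3 => \sum_i a i * x 0 i).
  by apply: polyfun_sum => i _; apply: polyfunM; [exact: polyfun_const|exact: polyfun_coord].
have h0 : polyfun xi0 by exact: lin.
have h1 : polyfun xi1 by exact: lin.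
have h2 : polyfun xi2 by exact: lin.
have hX : mxpolyfun X.
  apply: mxpolyfunD; first exact: mxpolyfunZ h2 (mxpolyfun_const _ _).
  exact: mxpolyfunN (mxpolyfun_scalar h0).
have hd := polyfun_det hX.
have hZ : mxpolyfun Z.
  apply/mxpolyfunN/mxpolyfunM; first exact: mxpolyfun_adj.
  apply: mxpolyfunD; first exact: mxpolyfunZ h2 (mxpolyfun_const _ _).
  exact: mxpolyfunN (mxpolyfun_scalar h1).
have hG : mxpolyfun Gam.
  apply/mxpolyfunN/mxpolyfunD; first exact: mxpolyfunZ.
  by apply: mxpolyfun_scalar; exact: polyfunM.
have h2d := polyfunM h2 hd.
apply: polyfunM => //; apply: polyfun_det; apply: mxpolyfun_sum => k _.
apply: mxpolyfun_sum => l _; apply: mxpolyfunZ; last exact: mxpolyfun_exp.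
apply: polyfunM; last exact: polyfunX.
apply: polyfunM; last exact: polyfunX.
apply: polyfunM; first exact: polyfun_const.
exact/polyfunX/polyfunN.
Qed.

Lemma dual_form_tangent x (t c : C) (u : 'cV_n) : (size r <= N)%N -> (sizeY r <= N)%N ->
  u != 0 -> (t *: H + K + c%:M) *m u = 0 -> xi0 x * t + xi1 x + xi2 x * c = 0 ->
  (xi2 x != 0 -> r.[- (xi0 x / xi2 x), c] = 0) -> dual_form x = 0.
Proof.
move=> rN rYN u0 Mu lin hr.
have [x2|x2] := eqVneq (xi2 x) 0; first by rewrite /dual_form x2 !mul0r.
suff Eu : E x *m u = 0 by rewrite /dual_form (kernel_det0 u0 Eu) mulr0.
have Xu : t *: (X x *m u) = - ((xi2 x *: K - (xi1 x)%:M) *m u).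
  exact: pencil_kernel_shift Mu lin.
have Zu : Z x *m u = (t * \det (X x)) *: u.
  rewrite /Z mulNmx -mulmxA -mulmxN -Xu -scalemxAr mulmxA mul_adj_mx mul_scalar_mx.
  by rewrite scalerA.
have Gu : Gam x *m u = (xi2 x * \det (X x) * c) *: u.
  rewrite /Gam mulNmx mulmxDl -scalemxAl Zu mul_scalar_mx scalerA -scalerDl -scaleNr.
  congr (_ *: _).
  have -> : xi1 x = - (xi0 x * t) - xi2 x * c.
    by apply/eqP; rewrite -subr_eq0 -lin; apply/eqP; ring.
  ring.
have Gku k : Gam x ^+ k *m u = (xi2 x * \det (X x) * c) ^+ k *: u.
  elim: k => [|k IH]; first by rewrite !expr0 mul1mx scale1r.
  by rewrite exprSr -mulmxE -mulmxA Gu -scalemxAr IH scalerA -exprS.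
rewrite /E mulmx_suml.
transitivity ((xi2 x ^+ N * (xi2 x * \det (X x)) ^+ N * r.[- (xi0 x / xi2 x), c]) *: u).
  rewrite (horner2_homog _ _ _ x2 rN rYN) scaler_suml; apply: eq_bigr => k _.
  rewrite mulmx_suml scaler_suml; apply: eq_bigr => l _.
  by rewrite -scalemxAl Gku scalerA.
by rewrite hr // mulr0 scale0r.
Qed.

(** At such a point X is a multiple of H and Gam = 0, so only the term k = l = 0 of E survives: r(0,
    0) times powers of nonzero scalars. *)
Lemma dual_form_neq0 x0 : r.[0, 0] != 0 -> (0 < N)%N -> xi0 x0 = 0 -> xi1 x0 = 0 -> xi2 x0 != 0 ->
  dual_form x0 != 0.
Proof.
move=> r0 N0 x00 x01 x02.
have dH : \det H != 0.
  by have := definite_unit eta_gt0 e_definite; rewrite unitmxE unitfE.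
have dX : \det (X x0) != 0.
  by rewrite /X x00 -scalemx1 scale0r subr0 detZ mulf_neq0 // expf_neq0.
have Gam0 : Gam x0 = 0 by rewrite /Gam x00 x01 scale0r mul0r -scalemx1 scale0r addr0 oppr0.
rewrite /dual_form !mulf_neq0 //.
have -> : E x0 = (r.[0, 0] * xi2 x0 ^+ N * (xi2 x0 * \det (X x0)) ^+ N)%:M.
  rewrite /E (bigD1 (Ordinal N0)) //= [X in _ + X]big1 ?addr0 => [|k k0]; last first.
    rewrite big1 // => l _; rewrite x00 oppr0 expr0n.
    by rewrite [_ == _ :> nat](negPf k0) mulr0 !mul0r scale0r.
  rewrite (bigD1 (Ordinal N0)) //= [X in _ + X]big1 ?addr0 => [|l l0]; last first.
    by rewrite Gam0 expr0n [_ == _ :> nat](negPf l0) scaler0.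
  by rewrite !expr0 mulr1 !subn0 polyC0 !horner_coef0 scalemx1.
rewrite det_scalar expf_neq0 // !mulf_neq0 // expf_neq0 // mulf_neq0 //.
Qed.

End DualForm.

Lemma dual_irreducible_avoid d f (x0 : 'rV[C]_3) : f \is d.-homog ->
  mdivides f (pencil_form A) ->
  \sum_i e i * x0 0 i = 0 -> \sum_i v i * x0 0 i = 0 -> x0 0 0 != 0 ->
  ~ dual_irreducible f x0.
Proof.
move=> fd fp x0e x0v x00.
have [r r0 hr] := frame_tangent_relation eta_gt0 e_definite v_hermitian fp.
pose N := (maxn (size r) (sizeY r)).+1.
have rN : (size r <= N)%N by rewrite (leq_trans (leq_maxl _ (sizeY r))).
have rYN : (sizeY r <= N)%N by rewrite (leq_trans (leq_maxr (size r) _)).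
have [g gE] := polyfun_dual_form r N.
have wE (x : 'I_3 -> C) : \sum_i w i * x i = x 0.
  by rewrite (bigD1 0) //= big1 => [|i i0]; rewrite /w ?(negPf i0) ?mul0r // mul1r addr0.
have p_kernel y : f.@[y] = 0 -> exists2 u : 'cV_n, u != 0 & pencil A y *m u = 0.
  move=> fy; apply: det0_kernel; rewrite -pencil_formE; case: fp => h ->.
  by rewrite mevalM fy mulr0.
move=> /(@zariski_closure_meval _ _ g) => gx0.
have := dual_form_neq0 r0 (ltn0Sn _ : (0 < N)%N) x0e x0v.
rewrite wE => /(_ x00); rewrite gE gx0 ?eqxx // => _ [y [y0 fy gy0 ->]]; split=> // t t0.
pose x : 'rV[C]_3 := t *: gradient f y.
have xE i : x 0 i = t * (f^`M(i)).@[y 0] by rewrite !mxE.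
rewrite (@meval_eq _ _ _ (x 0)) => [|i]; last by rewrite mxE.
rewrite -gE.
(* Euler's identity: a tangent line passes through its point of contact. *)
have lin0 : \sum_i y 0 i * x 0 i = 0.
  rewrite (eq_bigr (fun i => t * (y 0 i * (f^`M(i)).@[y 0]))) => [|i _]; last by rewrite xE mulrCA.
  by rewrite -mulr_sumr (euler_identity _ fd) fy !mulr0.
have [T [b [c yE]]] := frame_basis (y 0).
have lin : (\sum_i e i * x 0 i) * T + b * (\sum_i v i * x 0 i) + (\sum_i w i * x 0 i) * c = 0.
  rewrite -[RHS]lin0 mulr_suml mulr_sumr mulr_suml -!big_split; apply: eq_bigr => i _ /=.
  by rewrite yE; ring.
have pencilE : pencil A (y 0) = T *: H + b *: K + c%:M.
  rewrite -[c%:M]scalemx1 -(pencil_w A) /H /K /pencil !yE.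
  move: (pencil_coef0 C n) (pencil_coef1 A) (pencil_coef2 A) => B0 B1 B2.
  by apply/matrixP => i j; rewrite !mxE; ring.
(* Such a y lies outside the chart of the frame. The pencil at y is T H + c, and incidence makes its
   kernel vector one of X. *)
have [b0|b0] := eqVneq b 0.
  rewrite /dual_form; set x2 := \sum_i w i * _; set x1 := \sum_i e i * _.
  have [->|x20] := eqVneq x2 0; first by rewrite !mul0r.
  have [u u0] := p_kernel _ fy; rewrite pencilE b0 scale0r addr0 mulmxDl -scalemxAl mul_scalar_mx => Mu.
  suff -> : \det (x2 *: H - x1%:M) = 0 by rewrite mulr0 mul0r.
  move: lin; rewrite b0 mul0r addr0 -/x1 -/x2 => lin.
  have T0 : T != 0.
    apply: contraNneq y0 => T0; apply/eqP/rowP => i; rewrite mxE yE T0 b0 !mul0r !add0r.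
    move/eqP: lin; rewrite T0 mulr0 add0r mulf_eq0 (negPf x20) => /eqP->.
    by rewrite mul0r.
  apply: (kernel_det0 u0); rewrite mulmxDl mulNmx mul_scalar_mx -scalemxAl.
  apply: (scalerI T0); rewrite scaler0 scalerBr !scalerA [T * x2]mulrC [T * x1]mulrC.
  have -> : x1 * T = - (x2 * c) by apply/eqP; rewrite -addr_eq0 lin.
  by rewrite scaleNr opprK -!scalerA -scalerDr Mu scaler0.
(* Rescaling y into the chart multiplies the gradient only by a power of b. *)
pose y' := frame_point e v w (T / b) (c / b).
have yy' i : y 0 i = b * y' i.
  by rewrite yE /y' /frame_point; field.
have fy' : f.@[y'] = 0.
  move: fy; rewrite (meval_eq _ yy') (dhomog_meval _ _ fd) => /eqP.
  by rewrite mulf_eq0 expf_eq0 (negPf b0) andbF => /eqP.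
have x_y' i : x 0 i = t * b ^+ d.-1 * (f^`M(i)).@[y'].
  by rewrite xE (meval_eq _ yy') (dhomog_meval _ _ (mderiv_homog i fd)) mulrA.
have s0 : t * b ^+ d.-1 != 0 by rewrite mulf_neq0 // expf_neq0.
have sumE (a : 'I_3 -> C) : \sum_i a i * x 0 i = t * b ^+ d.-1 * \sum_i a i * (f^`M(i)).@[y'].
  by rewrite mulr_sumr; apply: eq_bigr => i _; rewrite x_y' mulrCA.
have [u u0 Mu] := p_kernel _ fy'.
rewrite (pencil_frame_point A e v) in Mu.
apply: (dual_form_tangent rN rYN u0 Mu).
  by apply: (mulfI b0); rewrite mulr0 -[RHS]lin; field.
rewrite !sumE -mulf_div divff // mul1r mulf_eq0 negb_or => /andP[_ Y0].
exact: hr.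
Qed.

End DualAvoidsDefiniteLines.

(** * Convexity and separation for the numerical range *)

Section RealAndImaginaryParts.
Variables (R : realType) (N : nat).
Local Open Scope complex_scope.

Lemma polyfun_min (G : set ('rV[R]_N -> R)) (q : 'rV[R]_N -> R) (B : R) :
  (forall g, G g -> polyfun g) -> polyfun q ->
  let Z (x : 'rV[R]_N) := forall g, G g -> g x = 0 in
  (exists x, Z x) -> (forall x, Z x -> forall i, `|x 0 i| <= B) ->
  exists2 x, Z x & forall y, Z y -> q x <= q y.
Proof.
move=> hG [p pE] Z [x0 Zx0] bnd.
pose G' : set {mpoly R[N]} := [set h | exists2 g : 'rV[R]_N -> R, G g & forall x, g x = h.@[x 0]].
have ZE x : Z x <-> forall h, G' h -> h.@[x 0] = 0.
  split=> [Zx h [g Gg <-]|Zx g Gg]; first exact: Zx.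
  by have [h gE] := hG g Gg; rewrite gE; apply: Zx; exists g.
have [] := @Compactness.min_on_bounded_zeros R N G' p B.
- by exists x0; apply/ZE.
- by move=> x /ZE; exact: bnd.
move=> x /ZE Zx xmin; exists x => // y /ZE Zy; rewrite !pE; exact: xmin.
Qed.

Implicit Types f g : 'rV[R]_N -> R[i].

Definition cpolyfun f := polyfun (fun x => complex.Re (f x)) /\ polyfun (fun x => complex.Im (f x)).

Lemma cpolyfun_ext f g : f =1 g -> cpolyfun f -> cpolyfun g.
Proof. by move=> fg [h1 h2]; split; [apply: polyfun_ext h1|apply: polyfun_ext h2] => x; rewrite fg. Qed.

Lemma cpolyfun_const c : cpolyfun (fun=> c).
Proof. by split; exact: polyfun_const. Qed.

Lemma cpolyfunD f g : cpolyfun f -> cpolyfun g -> cpolyfun (fun x => f x + g x).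
Proof.
move=> [f1 f2] [g1 g2]; split.
  by apply: polyfun_ext (polyfunD f1 g1) => x; case: (f x) (g x) => [a b] [].
by apply: polyfun_ext (polyfunD f2 g2) => x; case: (f x) (g x) => [a b] [].
Qed.

Lemma cpolyfunM f g : cpolyfun f -> cpolyfun g -> cpolyfun (fun x => f x * g x).
Proof.
move=> [f1 f2] [g1 g2]; split.
  apply: polyfun_ext (polyfunD (polyfunM f1 g1) (polyfunN (polyfunM f2 g2))) => x.
  by case: (f x) (g x) => [a b] [].
apply: polyfun_ext (polyfunD (polyfunM f1 g2) (polyfunM f2 g1)) => x.
by case: (f x) (g x) => [a b] [].
Qed.

Lemma cpolyfun_conj f : cpolyfun f -> cpolyfun (fun x => Num.conj (f x)).
Proof.
move=> [f1 f2]; split.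
  by apply: polyfun_ext f1 => x; case: (f x).
by apply: polyfun_ext (polyfunN f2) => x; case: (f x).
Qed.

Lemma cpolyfun_sum (I : Type) (r : seq I) (F : I -> 'rV[R]_N -> R[i]) :
  (forall i, cpolyfun (F i)) -> cpolyfun (fun x => \sum_(i <- r) F i x).
Proof.
move=> hF; elim: r => [|i r IHr].
  by apply: cpolyfun_ext (cpolyfun_const 0) => x; rewrite big_nil.
by apply: cpolyfun_ext (cpolyfunD (hF i) IHr) => x; rewrite big_cons.
Qed.

Lemma cpolyfun_meval n (p : {mpoly R[i][n]}) (F : 'I_n -> 'rV[R]_N -> R[i]) :
  (forall i, cpolyfun (F i)) -> cpolyfun (fun x => p.@[fun i => F i x]).
Proof.
move=> hF; elim/mpoly_ring_ind: p => [c|i|p q hp hq|p q hp hq].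
- by apply: cpolyfun_ext (cpolyfun_const c) => x; rewrite mevalC.
- by apply: cpolyfun_ext (hF i) => x; rewrite mevalXU.
- by apply: cpolyfun_ext (cpolyfunD hp hq) => x; rewrite mevalD.
- by apply: cpolyfun_ext (cpolyfunM hp hq) => x; rewrite mevalM.
Qed.

End RealAndImaginaryParts.

Section NumericalRangeForms.
Variables (C : numClosedFieldType) (n : nat).
Implicit Types (A B : 'M[C]_n) (u v : 'cV[C]_n).

Definition bform B u v : C := (u^t* *m B *m v) 0 0.

Lemma qformE B u : qform B u = bform B u u. Proof. by []. Qed.

Lemma bformDl B u1 u2 v : bform B (u1 + u2) v = bform B u1 v + bform B u2 v.
Proof. by rewrite /bform linearD /= map_mxD !mulmxDl mxE. Qed.

Lemma bformDr B u v1 v2 : bform B u (v1 + v2) = bform B u v1 + bform B u v2.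
Proof. by rewrite /bform mulmxDr mxE. Qed.

Lemma bformZl B c u v : bform B (c *: u) v = c^* * bform B u v.
Proof. by rewrite /bform linearZ /= map_mxZ -!scalemxAl mxE. Qed.

Lemma bformZr B c u v : bform B u (c *: v) = c * bform B u v.
Proof. by rewrite /bform -scalemxAr mxE. Qed.

Lemma qform_scale B c u : qform B (c *: u) = `|c| ^+ 2 * qform B u.
Proof. by rewrite !qformE bformZl bformZr mulrA normCKC. Qed.

Lemma numerical_rangeP A z :
  numerical_range A z <-> exists2 w : 'cV[C]_n, w != 0 & qform A w = z * qform 1%:M w.
Proof.
split=> [[w [w1 wA]]|[w w0 wA]].
  have q1 : qform 1%:M w = 1 by rewrite /qform mulmx1 w1 mxE eqxx.
  exists w; last by rewrite q1 mulr1 /qform wA mxE eqxx.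
  apply: contraTneq (oner_neq0 C) => w0; rewrite -q1 w0 /qform mulmx0 mxE.
  by rewrite eqxx.
have q0 := qform1_gt0 w0.
set r := (sqrtC (qform 1%:M w))^-1.
have r2 : `|r| ^+ 2 * qform 1%:M w = 1.
  rewrite ger0_norm ?invr_ge0 ?sqrtC_ge0 ?ltW // exprVn sqrtCK mulVf //.
  exact: lt0r_neq0.
exists (r *: w); split; apply/matrixP => i j; rewrite !ord1.
  rewrite -[_^t*]mulmx1 -[LHS]/(qform _ _) qform_scale r2 mxE eqxx //.
by rewrite -[LHS]/(qform _ _) qform_scale wA mulrCA r2 mulr1 mxE eqxx.
Qed.

Lemma pencil_coefE A w : qform A w = qform (pencil_coef1 A) w + 'i * qform (pencil_coef2 A) w.
Proof.
rewrite -qformZ -qformD /pencil_coef1 /pencil_coef2 scalerA; congr (qform _ w).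
apply/matrixP => i j; rewrite !mxE; field.
by rewrite neq0Ci.
Qed.

Lemma bformE B u v : bform B u v = \sum_i \sum_j (u i 0)^* * B i j * v j 0.
Proof.
rewrite /bform -mulmxA mxE; apply: eq_bigr => i _; rewrite !mxE mulr_sumr.
by apply: eq_bigr => j _; rewrite mulrA.
Qed.

Lemma bform_conj B u v : (bform B u v)^* = bform (B^t* ) v u.
Proof.
rewrite !bformE rmorph_sum exchange_big /=; apply: eq_bigr => i _.
rewrite rmorph_sum; apply: eq_bigr => j _ /=.
by rewrite !rmorphM /= conjCK !mxE mulrC mulrA [RHS]mulrAC mulrAC.
Qed.

Lemma qform_real B u : B^t* = B -> qform B u \is Num.real.
Proof. by move=> hB; apply/CrealP; rewrite qformE bform_conj hB. Qed.

Lemma pencil_coef1_herm A : (pencil_coef1 A)^t* = pencil_coef1 A.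
Proof.
apply/matrixP => i j; rewrite !mxE rmorphM rmorphD /= conjCK fmorphV rmorph_nat.
by rewrite addrC.
Qed.

Lemma pencil_coef2_herm A : (pencil_coef2 A)^t* = pencil_coef2 A.
Proof.
apply/matrixP => i j; rewrite !mxE rmorphM rmorphB /= conjCK fmorphV rmorphM rmorph_nat /=.
by rewrite conjCi mulrN invrN mulNr -mulrN opprB.
Qed.

Lemma pencil_real_herm A (y : 'I_3 -> C) : (forall i, y i \is Num.real) ->
  (pencil A y)^t* = pencil A y.
Proof.
move=> yr; rewrite /pencil.
have h0 : (pencil_coef0 C n)^t* = pencil_coef0 C n by rewrite /pencil_coef0 trmx1 map_mx1.
move: (pencil_coef0 C n) h0 (pencil_coef1 A) (pencil_coef1_herm A) (pencil_coef2 A)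
  (pencil_coef2_herm A) => B0 h0 B1 h1 B2 h2.
rewrite !linearD /= !linearZ /= !map_mxD !map_mxZ /= !conj_Creal //.
by rewrite h0 h1 h2.
Qed.

End NumericalRangeForms.

Section ToeplitzHausdorff.
Variables (R : realType) (n : nat).
Local Notation C := R[i].
Local Notation "x %:C" := (real_complex R x) : ring_scope.
Implicit Types (A B : 'M[C]_n) (u v w : 'cV[C]_n).

(** The imaginary part of the sum is that of m r, where r is p minus the conjugate of q; so m has to
    rotate r onto the real line. *)
Lemma phase_real (p q : C) : exists2 m : C, `|m| = 1 & m * p + m^* * q \is Num.real.
Proof.
have [pq|pq] := eqVneq (p - q^*) 0.
  exists 1; first by rewrite normr1.
  have -> : p = q^* by apply/eqP; rewrite -subr_eq0 pq.
  by apply/CrealP; rewrite rmorph1 !mul1r rmorphD /= conjCK addrC.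
set r := p - q^* in pq; have r0 : `|r| != 0 by rewrite normr_eq0.
exists (r^* / `|r|); first by rewrite normrM normfV norm_conjC normr_id divff.
apply/CrealP/eqP; rewrite -subr_eq0 rmorphD !rmorphM /= !conjCK fmorphV /= (conj_Creal (normr_real r)).
have -> : r / `|r| * p^* + r^* / `|r| * q^* - (r^* / `|r| * p + r / `|r| * q) =
   (r / `|r|) * (p - q^*)^* - (r^* / `|r|) * (p - q^*).
  by rewrite rmorphB /= conjCK; ring.
by rewrite -/r mulrAC [X in _ - X]mulrAC [r^* * r]mulrC subrr.
Qed.

(** Along the segment the form is a real quadratic polynomial in s, because the cross terms have a
    real sum; it changes sign. *)
Lemma isotropic_between B u v : qform B u <= 0 -> 0 <= qform B v ->
  bform B u v + bform B v u \is Num.real ->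
  exists2 s : R, 0 <= s <= 1 & qform B ((1 - s)%:C *: u + s%:C *: v) = 0.
Proof.
move=> Bu Bv /complex_realP[c cE].
have /complex_realP[a aE] : qform B u \is Num.real by rewrite ler0_real.
have /complex_realP[b bE] : qform B v \is Num.real by rewrite ger0_real.
pose P : {poly R} := a *: (1 - 'X) ^+ 2 + b *: 'X ^+ 2 + c *: ('X * (1 - 'X)).
have hP s : P.[s] = a * (1 - s) ^+ 2 + b * s ^+ 2 + c * (s * (1 - s)).
  by rewrite /P !hornerD !hornerZ !horner_exp !hornerM !hornerD !hornerN !hornerX !hornerC.
have PE s : qform B ((1 - s)%:C *: u + s%:C *: v) = (P.[s])%:C.
  rewrite qformE bformDl !bformDr !bformZl !bformZr -!qformE aE bE.
  have conjR (x : R) : (x%:C)^* = x%:C by apply: conj_Creal; apply/complex_realP; exists x.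
  rewrite !conjR.
  have -> : bform B v u = c%:C - bform B u v by rewrite -cE addrAC subrr add0r.
  rewrite hP !(rmorphD, rmorphM, rmorphXn, rmorphN, rmorph1) /=.
  move: (bform B u v) s%:C a%:C b%:C c%:C => x1 x2 x3 x4 x5; ring.
have P0 : P.[0] = a by rewrite hP; ring.
have P1 : P.[1] = b by rewrite hP; ring.
have [//||s s01 /rootP Ps] := @poly_ivt R P 0 1.
  by rewrite P0 P1 -!lecR -aE -bE Bu.
by exists s => //; rewrite PE Ps.
Qed.

Lemma numerical_range_convex A z1 z2 (t : R) : 0 <= t <= 1 ->
  numerical_range A z1 -> numerical_range A z2 ->
  numerical_range A ((1 - t)%:C * z1 + t%:C * z2).
Proof.
move=> /andP[t0 t1] W1 W2.
have [<-|z12] := eqVneq z1 z2.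
  by rewrite -mulrDl -rmorphD /= subrK mul1r.
move/numerical_rangeP: W1 => [w1 w10 Aw1]; move/numerical_rangeP: W2 => [w2 w20 Aw2].
set z := _ + _; set d := z2 - z1.
have d0 : d != 0 by rewrite subr_eq0 eq_sym.
(* This affine change sends z to 0, z1 to - t and z2 to 1 - t, so the form of B is nonpositive at w1
   and nonnegative at w2. *)
pose B := d^-1 *: (A + (- z) *: 1%:M).
have BE w : qform B w = d^-1 * (qform A w - z * qform 1%:M w).
  by rewrite qformZ qformD qformZ mulNr.
have tC0 : 0 <= t%:C by rewrite ler0c.
have tC1 : 0 <= (1 - t)%:C by rewrite ler0c subr_ge0.
have Bw1 : qform B w1 <= 0.
  have -> : qform B w1 = - (t%:C * qform 1%:M w1).
    rewrite BE Aw1 /z rmorphB rmorph1 /d; field; by rewrite -/d.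
  by rewrite oppr_le0 mulr_ge0 // ltW // qform1_gt0.
have Bw2 : 0 <= qform B w2.
  have -> : qform B w2 = (1 - t)%:C * qform 1%:M w2.
    rewrite BE Aw2 /z rmorphB rmorph1 /d; field; by rewrite -/d.
  by rewrite mulr_ge0 // ltW // qform1_gt0.
have [m m1 mr] := phase_real (bform B w1 w2) (bform B w2 w1).
have m0 : m != 0 by rewrite -normr_eq0 m1 oner_neq0.
have [||s _ Bs] := @isotropic_between B w1 (m *: w2) Bw1.
- by rewrite qform_scale m1 expr1n mul1r.
- by rewrite bformZl bformZr.
apply/numerical_rangeP; exists ((1 - s)%:C *: w1 + s%:C *: (m *: w2)).
  (* A zero combination would make w1 and w2 proportional, hence z1 = z2. *)
  apply: contraNneq z12 => w0.
  have [s0|s0] := eqVneq s 0.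
    move: w0; rewrite s0 subr0 scale1r scale0r addr0 => w0; by rewrite w0 eqxx in w10.
  have : w2 = (- (s%:C * m)^-1 * (1 - s)%:C) *: w1.
    have sm : s%:C * m != 0 by rewrite mulf_neq0 // fmorph_eq0.
    apply: (scalerI sm); rewrite scalerA mulNr mulrN mulrA divff // mul1r scaleNr.
    by apply/eqP; rewrite -addr_eq0 addrC -scalerA w0.
  set k := _ * _ => w2E; have k0 : k != 0.
    by apply: contraNneq w20 => k0; rewrite w2E k0 scale0r.
  have := Aw2; rewrite w2E !qform_scale Aw1 mulrCA => /mulIf -> //.
  by rewrite mulf_neq0 ?expf_neq0 ?normr_eq0 // gt_eqF // qform1_gt0.
by move: Bs; rewrite BE => /eqP; rewrite mulf_eq0 invr_eq0 (negPf d0) subr_eq0 => /eqP.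
Qed.

End ToeplitzHausdorff.

Section Separation.
Variable R : realType.
Local Notation C := R[i].
Local Notation "x %:C" := (real_complex R x) : ring_scope.
Local Notation Re := (@complex.Re R).
Local Notation Im := (@complex.Im R).

Definition cdot (a b : C) : R := Re a * Re b + Im a * Im b.

Lemma cdot_line (a b : C) (t : R) :
  cdot ((1 - t)%:C * a + t%:C * b) ((1 - t)%:C * a + t%:C * b) =
  cdot a a - 2 * t * (cdot a a - cdot a b) + t ^+ 2 * cdot (b - a) (b - a).
Proof. by case: a b => [a1 a2] [b1 b2]; rewrite /cdot /=; ring. Qed.

Lemma cdot_ge0 a : 0 <= cdot a a.
Proof. by rewrite addr_ge0 // -expr2 sqr_ge0. Qed.

Lemma cdot_gt0 a : a != 0 -> 0 < cdot a a.
Proof.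
move=> a0; rewrite lt_neqAle cdot_ge0 andbT eq_sym; apply: contraNneq a0 => /eqP.
rewrite /cdot paddr_eq0 -?expr2 ?sqr_ge0 // !sqrf_eq0 => /andP[h1 h2].
by rewrite eq_complex h1 h2.
Qed.

(** Otherwise the squared length along the segment, |a|^2 - 2 t d + t^2 m with d > 0, would drop
    below |a|^2 for small t. *)
Lemma nearest_point_separates (S : set C) (a : C) :
  (forall b t, S b -> 0 <= t <= 1 -> cdot a a <= cdot ((1 - t)%:C * a + t%:C * b) ((1 - t)%:C * a + t%:C * b)) ->
  forall b, S b -> cdot a a <= cdot a b.
Proof.
move=> hS b Sb; rewrite leNgt; apply/negP; rewrite -subr_gt0.
set d := cdot a a - cdot a b => d0; set m := cdot (b - a) (b - a).
have m0 : 0 <= m by exact: cdot_ge0.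
have dm : 0 < d + m by rewrite ltr_wpDr.
have [t [t0 t1 tm]] : exists t, [/\ 0 < t, t <= 1 & t * m <= d].
  exists (d / (d + m)); split; first by rewrite divr_gt0.
    by rewrite ler_pdivrMr // mul1r lerDl.
  by rewrite mulrAC ler_pdivrMr // ler_pM2l // lerDr ltW.
have := hS b t Sb; rewrite (ltW t0) t1 cdot_line -/d -/m => /(_ isT).
rewrite -addrA lerDl addrC subr_ge0 expr2 -!mulrA mulrCA ler_pM2l // => h.
have := le_trans h tm; rewrite -subr_ge0 (_ : d - 2 * d = - d); last by ring.
by rewrite oppr_ge0 leNgt d0.
Qed.

End Separation.

Lemma qform_pencil (C : numClosedFieldType) n (A : 'M[C]_n) y u :
  qform (pencil A y) u = y 0 * qform 1%:M u + y 1 * qform (pencil_coef1 A) u +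
    y 2%:R * qform (pencil_coef2 A) u.
Proof.
rewrite /pencil -[pencil_coef0 C n]/(1%:M : 'M_n).
move: (1%:M : 'M[C]_n) (pencil_coef1 A) (pencil_coef2 A) => B0 B1 B2.
by rewrite !qformD !qformZ.
Qed.

Lemma complex_iE (R : rcfType) : 'i = Complex 0 1 :> R[i].
Proof. by []. Qed.

Section NumericalRangeSeparation.
Variables (R : realType) (n : nat).
Hypothesis n_gt0 : (0 < n)%N.
Local Notation C := R[i].
Local Notation "x %:C" := (real_complex R x) : ring_scope.
Implicit Types (A B : 'M[C]_n).

Let vec (x : 'rV[R]_(n + n)) : 'cV[C]_n :=
  \col_i Complex (x 0 (lshift n i)) (x 0 (rshift n i)).

Let vec_surj (w : 'cV[C]_n) : exists x, vec x = w.
Proof.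
exists (row_mx (\row_i complex.Re (w i 0)) (\row_i complex.Im (w i 0))).
by apply/colP => i; rewrite mxE row_mxEl row_mxEr !mxE; case: (w i 0).
Qed.

Let cpolyfun_qform B : cpolyfun (fun x => qform B (vec x)).
Proof.
apply: (@cpolyfun_ext _ _ (fun x => \sum_i \sum_j Num.conj (vec x i 0) * B i j * vec x j 0)).
  by move=> x; rewrite qformE bformE.
have hv i : cpolyfun (fun x => vec x i 0).
  apply: (@cpolyfun_ext _ _ (fun x => Complex (x 0 (lshift n i)) (x 0 (rshift n i)))).
    by move=> x; rewrite mxE.
  by split; exact: polyfun_coord.
apply: cpolyfun_sum => i; apply: cpolyfun_sum => j.
apply: cpolyfunM => //; apply: cpolyfunM; last exact: cpolyfun_const.
exact: cpolyfun_conj.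
Qed.

(** In real coordinates the unit sphere is the zero set of one polynomial, and the squared modulus
    of the form is a polynomial on it. *)
Lemma numerical_range_min B : exists2 a, numerical_range B a &
  forall b, numerical_range B b -> cdot a a <= cdot b b.
Proof.
have [r1 i1] := cpolyfun_qform 1%:M; have [rB iB] := cpolyfun_qform B.
pose G : set ('rV[R]_(n + n) -> R) := [set (fun x => complex.Re (qform 1%:M (vec x)) - 1)].
have ZE x : (forall g, G g -> g x = 0) <-> qform 1%:M (vec x) = 1.
  have qr : qform 1%:M (vec x) \is Num.real by rewrite qform1 rpred_sum // => i _; rewrite rpredX // normr_real.
  split=> [h|h g ->]; last by rewrite h subrr.
  rewrite -(RRe_real qr); have := h _ erefl => /eqP; rewrite subr_eq0 => /eqP->.
  by [].
have [] := @polyfun_min R (n + n) G (fun x => cdot (qform B (vec x)) (qform B (vec x))) 1.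
- by move=> g ->; apply: polyfunD => //; exact: polyfun_const.
- by apply: polyfunD; apply: polyfunM.
- have [x xE] := vec_surj (\col_i (i == Ordinal n_gt0)%:R); exists x; apply/ZE.
  rewrite xE qform1 (bigD1 (Ordinal n_gt0)) //= big1 => [|i i0]; rewrite !mxE ?(negPf i0).
    by rewrite eqxx normr1 expr1n addr0.
  by rewrite normr0 expr0n.
- move=> x /ZE; rewrite qform1 => qx k.
  have nE i : `|vec x i 0| ^+ 2 = (x 0 (lshift n i) ^+ 2 + x 0 (rshift n i) ^+ 2)%:C.
    by rewrite mxE -add_Re2_Im2.
  have qR : \sum_i (x 0 (lshift n i) ^+ 2 + x 0 (rshift n i) ^+ 2) = 1.
    by apply: complexI; rewrite rmorph_sum rmorph1 -qx; apply: eq_bigr => i _; rewrite nE.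
  rewrite -(@ler_pXn2r _ 2) ?nnegrE // expr1n real_normK ?num_real // -qR.
  have ge0 i : 0 <= x 0 (lshift n i) ^+ 2 + x 0 (rshift n i) ^+ 2 by rewrite addr_ge0 ?sqr_ge0.
  have rest i : 0 <= \sum_(j | j != i) (x 0 (lshift n j) ^+ 2 + x 0 (rshift n j) ^+ 2).
    by apply: sumr_ge0.
  case: (split_ordP k) => i ->; rewrite (bigD1 i) //= -addrA.
    by rewrite lerDl addr_ge0 ?sqr_ge0.
  by rewrite addrCA lerDl addr_ge0 ?sqr_ge0.
move=> x /ZE qx xmin; exists (qform B (vec x)).
  apply/numerical_rangeP; exists (vec x); last by rewrite qx mulr1.
  apply: contraTneq (oner_neq0 C) => v0; rewrite -qx v0 /qform mulmx0 mxE; by rewrite eqxx.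
move=> b [w [w1 wB]].
have [y yE] := vec_surj w.
have := xmin y; rewrite yE.
have -> : qform B w = b by rewrite /qform wB mxE eqxx.
by apply; apply/ZE; rewrite yE /qform mulmx1 w1 mxE eqxx.
Qed.

(** Here a is the point of W(A) - z nearest to 0. At a unit vector with value b + z in W(A) the form
    of the pencil is the dot product of a and b, at least |a|^2. The first coordinate makes the
    direction orthogonal to (1, Re z, Im z). *)
Lemma numerical_range_separation A z : ~ numerical_range A z ->
  exists2 a : C, a != 0 & forall u, (cdot a a)%:C * qform 1%:M u <=
    qform (pencil A (fun i => ([:: - (cdot a z); complex.Re a; complex.Im a]`_i)%:C)) u.
Proof.
move=> zW.
pose B := A + (- z) *: 1%:M.
have BE w : qform B w = qform A w - z * qform 1%:M w by rewrite qformD qformZ mulNr.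
have BW b : numerical_range B b <-> numerical_range A (b + z).
  split=> /numerical_rangeP[w w0 wE]; apply/numerical_rangeP; exists w => //.
    by rewrite mulrDl -wE BE subrK.
  by rewrite BE wE mulrDl addrK.
have [a Wa amin] := numerical_range_min B.
have a0 : a != 0 by apply: contra_notN zW => /eqP a0; rewrite -[z]add0r -a0; apply/BW.
exists a => // u.
have sep : forall b, numerical_range B b -> cdot a a <= cdot a b.
  apply: nearest_point_separates => b t Wb t01; apply: amin.
  exact: numerical_range_convex.
have [->|u0] := eqVneq u 0.
  by rewrite /qform !mulmx0 !mxE mulr0.
have qu := qform1_gt0 u0.
have qur : qform 1%:M u \is Num.real by rewrite gtr0_real.
have {sep} := sep (qform B u / qform 1%:M u); set b := _ / _ => sep.
have qBu : qform B u = b * qform 1%:M u by rewrite /b divfK // lt0r_neq0.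
have {}sep : cdot a a <= cdot a b by apply: sep; apply/numerical_rangeP; exists u.
suff -> : qform (pencil A (fun i : 'I_3 =>
    ([:: - (cdot a z); complex.Re a; complex.Im a]`_i)%:C)) u = (cdot a b)%:C * qform 1%:M u.
  by rewrite ler_pM2r // lecR.
have r1 : qform (pencil_coef1 A) u \is Num.real := qform_real _ (pencil_coef1_herm A).
have r2 : qform (pencil_coef2 A) u \is Num.real := qform_real _ (pencil_coef2_herm A).
rewrite qform_pencil /=.
have := BE u; rewrite (pencil_coefE A u) qBu.
case/complex_realP: r1 => x1 ->; case/complex_realP: r2 => x2 ->.
case/complex_realP: qur => q ->; rewrite complex_iE.
clearbody b; clear sep qBu; move: b a z {Wa amin a0 zW B BE BW} => [b1 b2] [a1 a2] [z1 z2] /eqP.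
rewrite eq_complex /cdot /= => /andP[/eqP h1 /eqP h2].
rewrite -!rmorphM -!rmorphD /=; congr (_%:C).
have -> : x1 = b1 * q - b2 * 0 + (z1 * q - z2 * 0) by rewrite h1; ring.
have -> : x2 = b1 * 0 + b2 * q + (z1 * 0 + z2 * q) by rewrite h2; ring.
ring.
Qed.

End NumericalRangeSeparation.

Section PencilForm.
Variables (C : numClosedFieldType) (n : nat) (A : 'M[C]_n).

Lemma pencil_form_homog : pencil_form A \is n.-homog.
Proof.
have hprod m (F : 'I_m -> {mpoly C[3]}) : (forall i, F i \is 1.-homog) ->
    \prod_(i < m) F i \is m.-homog.
  elim: m F => [|m IHm] F hF; first by rewrite big_ord0 dhomog1.
  by rewrite big_ord_recl; apply: (@dhomogM _ _ _ 1 _ m) => //; apply: IHm.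
rewrite /pencil_form; apply: rpred_sum => s _.
rewrite -signr_odd mulr_sign; case: odd => //; rewrite ?rpredN; apply: hprod => i;
  rewrite !mxE; do ! apply: rpredD; by rewrite mulrC mul_mpolyC rpredZ // dhomogX /= mdeg1.
Qed.

Lemma pencil_form_neq0 : pencil_form A != 0.
Proof.
apply: contraTneq (oner_neq0 C) => p0.
have := pencil_formE A (fun i => (i == 0)%:R); rewrite p0 meval0 pencil_w det1 => <-.
by rewrite eqxx.
Qed.

Lemma pencil_factor_homog f : mdivides f (pencil_form A) -> exists d, f \is d.-homog.
Proof. by move=> [g]; apply: dhomog_factor pencil_form_neq0 pencil_form_homog. Qed.

End PencilForm.

Section DualPointsInRange.
Variables (R : realType) (n : nat).
Hypothesis n_gt0 : (0 < n)%N.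
Local Notation C := R[i].
Local Notation "x %:C" := (real_complex R x) : ring_scope.
Variable A : 'M[C]_n.

Lemma real_dual_points_in_range z :
  real_dual_points (pencil_form A) (chart_point z) -> numerical_range A z.
Proof.
move=> [f [_ fp fz]]; apply: contrapT => zW.
have [d fd] := pencil_factor_homog fp.
have [a a0 esep] := numerical_range_separation n_gt0 zW.
set e := (fun i : 'I_3 => _) in esep.
(* The last two coordinates are those of e turned by a right angle; the first makes v orthogonal to
   [chart_point z]. *)
pose v (i : 'I_3) : C :=
  ([:: complex.Im a * complex.Re z - complex.Re a * complex.Im z; - complex.Im a; complex.Re a]`_i)%:C.
have ad := cdot_gt0 a0.
have ad0 : 0 < (cdot a a)%:C by rewrite ltcR.
have vr u : qform (pencil A v) u \is Num.real.
  apply/qform_real/pencil_real_herm => i; rewrite /v complex_real //.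
apply: (dual_irreducible_avoid ad0 esep vr _ fd fp _ _ _ fz).
(* The components along e and v are the dot and cross products of a with (y_1, y_2), divided by
   |a|^2. *)
- move=> y; exists ((complex.Re a)%:C / (cdot a a)%:C * y 1 + (complex.Im a)%:C / (cdot a a)%:C * y 2%:R).
  exists ((complex.Re a)%:C / (cdot a a)%:C * y 2%:R - (complex.Im a)%:C / (cdot a a)%:C * y 1).
  set x := _ + _; set b := _ - _; exists (y 0 - x * e 0 - b * v 0) => i.
  have [->|i0] := eqVneq i 0; first by rewrite mulr1; ring.
  rewrite mulr0 addr0 /x /b /e /v.
  have aaE : (cdot a a)%:C = (complex.Re a)%:C * (complex.Re a)%:C + (complex.Im a)%:C * (complex.Im a)%:C.
    by rewrite /cdot rmorphD !rmorphM.
  have : (cdot a a)%:C != 0 := lt0r_neq0 ad0; rewrite aaE => aa0.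
  case: i i0 => [[|[|[|//]]] ?] //= _; rewrite ?rmorphN.
    by rewrite (_ : Ordinal _ = 1); [field | apply/val_inj].
  by rewrite (_ : Ordinal _ = 2%:R); [field | apply/val_inj].
- rewrite !big_ord_recl big_ord0 /e !mxE /= /cdot.
  by rewrite !(rmorphN, rmorphD, rmorphM, rmorph1) /=; ring.
- rewrite !big_ord_recl big_ord0 /v !mxE /=.
  by rewrite !(rmorphN, rmorphB, rmorphD, rmorphM, rmorph1) /=; ring.
- by rewrite !mxE /= oner_neq0.
Qed.

Lemma numerical_range_convex_sum m (t : 'I_m -> R) (s : 'I_m -> C) :
  (forall j, 0 <= t j) -> \sum_j t j = 1 -> (forall j, numerical_range A (s j)) ->
  numerical_range A (\sum_j (t j)%:C * s j).
Proof.
elim: m t s => [|m IHm] t s t0 t1 sW.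
  by move: t1; rewrite big_ord0 => /eqP; rewrite eq_sym oner_eq0.
rewrite big_ord_recl; rewrite big_ord_recl in t1.
set t' := \sum_(i < m) t _ in t1.
have t'0 : 0 <= t' by apply: sumr_ge0.
have tE : t ord0 = 1 - t' by rewrite -t1 addrK.
have [t'z|t'z] := eqVneq t' 0.
  rewrite big1 ?addr0 => [|i _]; first by rewrite tE t'z subr0 mul1r.
  have : t (lift ord0 i) == 0.
    rewrite eq_le t0 andbT -t'z /t' (bigD1 i) //= lerDl; exact: sumr_ge0.
  by move=> /eqP->; rewrite mul0r.
have -> : \sum_(i < m) (t (lift ord0 i))%:C * s (lift ord0 i) =
   t'%:C * \sum_(i < m) (t (lift ord0 i) / t')%:C * s (lift ord0 i).
  rewrite mulr_sumr; apply: eq_bigr => i _; by rewrite mulrA -rmorphM /= [t' * _]mulrC divfK.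
rewrite tE; apply: numerical_range_convex => //.
  by rewrite t'0 -subr_ge0 -tE t0.
apply: IHm => // [j|]; first by rewrite divr_ge0.
by rewrite -mulr_suml divff.
Qed.

End DualPointsInRange.

(** * Irreducible factors of the pencil form *)

Section IrreducibleFactors.
Variable F : fieldType.
Implicit Types f g h p : {mpoly F[3]}.

Lemma mpoly_unit_msize p : (p \is a GRing.unit) = (msize p == 1%N).
Proof.
apply/idP/idP => [pu|/msize_poly1P[c c0 ->]].
  have [q pq] : exists q, q * p = 1 by exists p^-1; rewrite mulVr.
  have p0 : p != 0 by apply: contraTneq (oner_neq0 {mpoly F[3]}) => p0; rewrite -pq p0 mulr0 eqxx.
  have q0 : q != 0 by apply: contraTneq (oner_neq0 {mpoly F[3]}) => q0; rewrite -pq q0 mul0r eqxx.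
  have := msizeM q0 p0; rewrite pq msize1.
  rewrite (mpolySpred [measure of mdeg] p0) (mpolySpred [measure of mdeg] q0) addSn addnS /= => -[] /esym/eqP.
  by rewrite addn_eq0 => /andP[_ /eqP->].
by rewrite rmorph_unit // unitfE.
Qed.

Lemma irreducible_factorization p : p != 0 -> p \isn't a GRing.unit ->
  exists2 s : seq {mpoly F[3]}, forall f, f \in s -> mirreducible f & p = \prod_(f <- s) f.
Proof.
elim: {p}(msize p) {-2}p (leqnn (msize p)) => [|k IHk] p sp p0 pu.
  by move: sp; rewrite leqn0 msize_poly_eq0 (negPf p0).
have [pirr|pirr] := pselect (mirreducible p).
  by exists [:: p]; [move=> f; rewrite inE => /eqP-> | rewrite big_seq1].
have [g [h [pE gu hu]]] : exists g h, [/\ p = g * h, g \isn't a GRing.unit & h \isn't a GRing.unit].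
  apply: contrapT => H; apply: pirr; split=> // g h pE.
  have [gu|gu] := boolP (g \is a GRing.unit); first by left.
  have [hu|hu] := boolP (h \is a GRing.unit); first by right.
  by case: H; exists g, h.
have g0 : g != 0 by apply: contraNneq p0 => g0; rewrite pE g0 mul0r.
have h0 : h != 0 by apply: contraNneq p0 => h0; rewrite pE h0 mulr0.
have := msizeM g0 h0; rewrite -pE => spE.
move: gu hu; rewrite !mpoly_unit_msize => gu hu.
have sg : (1 < msize g)%N by rewrite ltn_neqAle eq_sym gu lt0n msize_poly_eq0.
have sh : (1 < msize h)%N by rewrite ltn_neqAle eq_sym hu lt0n msize_poly_eq0.
have [||] := IHk g _ g0; rewrite ?mpoly_unit_msize //.
  by move: sp sg sh; rewrite spE; move: (msize g) (msize h) => a b; lia.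
move=> s1 hs1 gE.
have [||] := IHk h _ h0; rewrite ?mpoly_unit_msize //.
  by move: sp sg sh; rewrite spE; move: (msize g) (msize h) => a b; lia.
move=> s2 hs2 hE; exists (s1 ++ s2); last by rewrite big_cat /= -gE -hE.
by move=> f; rewrite mem_cat => /orP[]; [exact: hs1|exact: hs2].
Qed.

(** The substitution X_1 = 0. Its kernel consists of the multiples of X_1, so X_1 is prime. *)
Let kill1 (p : {mpoly F[3]}) : {mpoly F[3]} :=
  p \mPo [tuple (if i == 1 then 0 else 'X_i) | i < 3].

Let kill1_tnth (i : 'I_3) : kill1 'X_i = (if i == 1 then 0 else 'X_i).
Proof. by rewrite /kill1 comp_mpolyXU -tnth_nth tnth_mktuple. Qed.

Let kill1P p : exists q, p = 'X_1 * q + kill1 p.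
Proof.
elim/mpoly_ring_ind: p => [c|i|p q [p' pE] [q' qE]|p q [p' pE] [q' qE]].
- by exists 0; rewrite mulr0 add0r /kill1 comp_mpolyC.
- rewrite kill1_tnth; have [->|i1] := eqVneq i 1; first by exists 1; rewrite mulr1 addr0.
  by exists 0; rewrite mulr0 add0r.
- exists (p' + q'); rewrite /kill1 comp_mpolyD -/(kill1 p) -/(kill1 q) {1}pE {1}qE.
  by rewrite mulrDr addrACA.
- exists (p' * q + kill1 p * q'); rewrite /kill1 rmorphM /= -/(kill1 p) -/(kill1 q).
  rewrite {1}pE mulrDl {2}qE; ring.
Qed.

Lemma mulX1_factor f a b : 'X_1 * f = a * b ->
  (exists q, a = 'X_1 * q) \/ (exists q, b = 'X_1 * q).
Proof.
move=> fab.
have : kill1 a * kill1 b = 0.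
  by rewrite /kill1 -rmorphM -fab rmorphM /= -/(kill1 'X_1) kill1_tnth eqxx mul0r.
move/eqP; rewrite mulf_eq0 => /orP[] /eqP k0.
  by left; have [q aE] := kill1P a; exists q; rewrite {1}aE k0 addr0.
by right; have [q aE] := kill1P b; exists q; rewrite {1}aE k0 addr0.
Qed.

Lemma mpolyX_neq0 (i : 'I_3) : 'X_i != 0 :> {mpoly F[3]}.
Proof. by rewrite -msize_poly_eq0 msizeX. Qed.

Lemma X1n_factor M f a b : 'X_1 ^+ M * f = a * b ->
  exists i j a' b', [/\ a = 'X_1 ^+ i * a', b = 'X_1 ^+ j * b' & f = a' * b'].
Proof.
elim: M a b => [|M IHM] a b.
  by rewrite mul1r => ->; exists 0%N, 0%N, a, b; rewrite !mul1r.
rewrite exprS -mulrA => fab.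
case: (mulX1_factor fab) => -[q qE].
  have /IHM[i [j [a' [b' [h1 h2 h3]]]]] : 'X_1 ^+ M * f = q * b.
    by apply: (mulfI (mpolyX_neq0 1)); rewrite fab qE mulrA.
  by exists i.+1, j, a', b'; rewrite qE h1 exprS mulrA.
have /IHM[i [j [a' [b' [h1 h2 h3]]]]] : 'X_1 ^+ M * f = a * q.
  by apply: (mulfI (mpolyX_neq0 1)); rewrite fab qE mulrCA.
by exists i, j.+1, a', b'; rewrite qE h2 exprS mulrA.
Qed.

End IrreducibleFactors.

Section StandardFrame.
Variables (C : numClosedFieldType) (n : nat) (A : 'M[C]_n).
Implicit Types (f g : {mpoly C[3]}) (D : {poly {poly C}}).

(** The chart y_1 = 1, again with a direction e where the pencil is definite, namely I. Now t runs
    along y_2, so that t = c corresponds to the direction Re + c Im. *)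
Definition std_frame : {mpoly C[3]} -> {poly {poly C}} :=
  in_frame (fun i => (i == 0)%:R) (fun i => (i == 1)%:R) (fun i => (i == 2%:R)%:R).

Definition std_point (x y : C) : 'I_3 -> C :=
  frame_point (fun i => (i == 0)%:R) (fun i => (i == 1)%:R) (fun i => (i == 2%:R)%:R) x y.

Lemma std_pointE x y i : std_point x y i = [:: x; 1; y]`_i.
Proof.
rewrite /std_point /frame_point; case: i => [[|[|[|//]]] ?] /=;
  by rewrite ?mulr0 ?mulr1 ?addr0 ?add0r.
Qed.

Lemma std_frame_derivX f x y : (std_frame f)^`().[x, y] = f^`M(0).@[std_point x y].
Proof.
rewrite horner_in_frame_derivX (bigD1 0) //= big1 => [|i i0]; first by rewrite mul1r addr0.
by rewrite (negPf i0) mul0r.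
Qed.

Lemma std_frame_derivY f x y : (derivY (std_frame f)).[x, y] = f^`M(2%:R).@[std_point x y].
Proof.
rewrite horner_in_frame_derivY (bigD1 2%:R) //= big1 => [|i i0]; first by rewrite ?eqxx mul1r addr0.
by rewrite (negPf i0) mul0r.
Qed.

Lemma std_frame_lead f : mdivides f (pencil_form A) ->
  exists2 k, k != 0 & lead_coef (std_frame f) = k%:P.
Proof.
move=> [g pE].
have e0 : pencil A (fun i => (i == 0)%:R) = 1%:M := pencil_w A.
have := @in_frame_pencil_lead _ _ A (fun i => (i == 0)%:R) (fun i => (i == 1)%:R)
  (fun i => (i == 2%:R)%:R).
rewrite e0 unitmx1 det1 => /(_ isT); rewrite pE in_frameM -/(std_frame f) lead_coefM => lE.
apply/size_poly1P.
have := congr1 (fun p : {poly C} => size p) lE; rewrite size_poly1.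
set a := lead_coef _ in lE *; set b := lead_coef _ in lE *.
have ab0 : a * b != 0 by rewrite lE oner_neq0.
move: (ab0); rewrite mulf_eq0 negb_or => /andP[a0 b0].
rewrite size_mul //; move: a0 b0; rewrite -!size_poly_gt0.
by case: (size a) => // k _; case: (size b) => // [[//|l]] _; rewrite addSn addnS /= addnS.
Qed.

(** A form of degree 2N which restricts to D on y_1 = 1 once both partial sizes of D are at most
    N. *)
Definition homogenize N D : {mpoly C[3]} :=
  \sum_(i < N) \sum_(j < N) D`_i`_j *: ('X_0 ^+ i * 'X_2%:R ^+ j * 'X_1 ^+ (N - i + (N - j))).

Lemma meval_homogenize N D (y : 'I_3 -> C) : (size D <= N)%N -> (sizeY D <= N)%N -> y 1 != 0 ->
  (homogenize N D).@[y] = y 1 ^+ (N + N) * D.[y 0 / y 1, y 2%:R / y 1].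
Proof.
move=> sD sYD y1; rewrite (horner2_coef _ _ sD sYD) /homogenize raddf_sum mulr_sumr.
apply: eq_bigr => i _; rewrite raddf_sum mulr_sumr; apply: eq_bigr => j _ /=.
rewrite mevalZ !mevalM !rmorphXn /= !mevalXU.
have iN : (i <= N)%N by rewrite ltnW.
have jN : (j <= N)%N by rewrite ltnW.
rewrite exprD !exprMn !exprVn.
have -> : (N + N = (N - i + (N - j)) + (i + j))%N by rewrite addnACA !subnK.
rewrite !exprD; have h1 := expf_neq0 i y1; have h2 := expf_neq0 j y1.
move: (y 1 ^+ i) (y 1 ^+ j) (y 1 ^+ (N - i)) (y 1 ^+ (N - j)) h1 h2 => a b c d a0 b0.
by field; rewrite a0 b0.
Qed.

Lemma mpoly_eq_offX1 f g : (forall y : 'I_3 -> C, y 1 != 0 -> f.@[y] = g.@[y]) -> f = g.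
Proof.
move=> fg; apply/eqP; rewrite -subr_eq0; apply/eqP/(mulfI (@mpolyX_neq0 C 1)).
rewrite mulr0; apply: meval_nat_eq0 => v; rewrite mevalM mevalXU mevalB.
have [->|v1] := eqVneq (v 1)%:R (0 : C); first by rewrite mul0r.
by rewrite fg // subrr mulr0.
Qed.

(** The polynomial r comes from a Bezout relation U G + V G' = r and acts as a discriminant: off its
    zeros, the roots of f in x are simple. *)
Lemma irreducible_squarefree f : mirreducible f -> mdivides f (pencil_form A) ->
  exists2 r : {poly C}, r != 0 & forall x y, f.@[std_point x y] = 0 ->
    f^`M(0).@[std_point x y] = 0 -> r.[y] = 0.
Proof.
move=> [f0 fu firr] fp.
have [d fd] := pencil_factor_homog fp.
have [k k0 kE] := std_frame_lead fp.
set F := std_frame f in kE.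
pose G := k^-1%:P *: F.
have Gm : G \is monic by rewrite monicE lead_coefZ kE -polyCM mulVf.
have GE x y : G.[x, y] = k^-1 * f.@[std_point x y].
  by rewrite hornerZ hornerM hornerC horner_in_frame.
have G'E x y : (G^`()).[x, y] = k^-1 * f^`M(0).@[std_point x y].
  by rewrite derivZ hornerZ hornerM hornerC std_frame_derivX.
have [G1|G1] := leqP (size G) 1.
  exists 1; first by rewrite oner_neq0.
  move=> x y fxy _; have := GE x y; rewrite fxy mulr0 (size1_polyC G1).
  have := monicP Gm; rewrite {1}(size1_polyC G1) lead_coefC => ->.
  by rewrite !hornerC => /eqP; rewrite oner_eq0.
have [/Pdiv.Idomain.Bezout_coprimepP[[U V] /=]|ncop] := boolP (coprimep G G^`()).
  rewrite -size_poly_eq1 => /size_poly1P[r r0 UV]; exists r => // x y fxy f'xy.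
  have := congr1 (fun p : {poly {poly C}} => p.[x, y]) UV.
  by rewrite hornerC !hornerD !hornerM GE G'E fxy f'xy !mulr0 addr0.
(* By Gauss's lemma, a common factor of G and G' would factor G, hence X_1^M f
   by homogenization, hence f since X_1 is prime. *)
have [D [H [[DH Dm Hm] [D1 H1]]]] := gauss_monic Gm G1 (monic_deriv_neq0 Gm G1) ncop.
exfalso.
pose N := maxn (maxn (size D) (sizeY D)) (maxn (size H) (sizeY H)).
have ND : (size D <= N)%N /\ (sizeY D <= N)%N by rewrite /N; split; rewrite !leq_max leqnn ?orbT.
have NH : (size H <= N)%N /\ (sizeY H <= N)%N by rewrite /N; split; rewrite !leq_max leqnn ?orbT.
(* The scalar k undoes the normalization of G, and X_1^d balances the degrees: both sides have
   degree 4N + d. *)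
pose a := k *: ('X_1 ^+ d * homogenize N D); pose b := homogenize N H.
have fab : 'X_1 ^+ (N + N + (N + N)) * f = a * b.
  apply: mpoly_eq_offX1 => y y1.
  rewrite !mevalM mevalZ mevalM !rmorphXn /= mevalXU !meval_homogenize //; try tauto.
  have -> : f.@[y] = y 1 ^+ d * f.@[std_point (y 0 / y 1) (y 2%:R / y 1)].
    rewrite -(dhomog_meval _ _ fd); apply: meval_eq => i.
    rewrite std_pointE; case: i => [[|[|[|//]]] ?] /=; rewrite ?mulr1 1?mulrC ?divfK //;
      by congr (y _); apply/val_inj.
  have -> : f.@[std_point (y 0 / y 1) (y 2%:R / y 1)] =
     k * (D.[y 0 / y 1, y 2%:R / y 1] * H.[y 0 / y 1, y 2%:R / y 1]).
    by rewrite -!hornerM -DH GE mulrA divff // mul1r.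
  rewrite exprD; ring.
have [i [j [a' [b' [aE bE fE]]]]] := X1n_factor fab.
(* The right side is a nonzero constant where X_1 = 1, whereas the left side vanishes there at a
   root of E(., 0). *)
have no_unit (E : {poly {poly C}}) (c : C) l (q : {mpoly C[3]}) m : c != 0 -> E \is monic -> (1 < size E)%N ->
   (size E <= N)%N -> (sizeY E <= N)%N ->
   q \is a GRing.unit -> c *: ('X_1 ^+ m * homogenize N E) = 'X_1 ^+ l * q -> False.
  move=> c0 Em E1 sE sYE; rewrite mpoly_unit_msize => /msize_poly1P[t t0 ->] eqE.
  have [x] : exists x, root (map_poly (horner_eval 0) E) x.
    apply/closed_rootP; rewrite size_map_poly_id0; first by rewrite neq_ltn E1 orbT.
    by rewrite (monicP Em) /horner_eval hornerC oner_neq0.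
  rewrite /root -horner2_eval => /eqP Ex.
  have := congr1 (meval (std_point x 0)) eqE.
  rewrite mevalZ !mevalM !rmorphXn /= mevalXU mevalC meval_homogenize ?std_pointE ?oner_neq0 //=.
  rewrite !divr1 Ex !mulr0 !expr1n mul1r => /esym/eqP; by rewrite (negPf t0).
case: (firr _ _ fE) => [a'u|b'u].
  by apply: (no_unit D k i a' d) => //; tauto.
apply: (no_unit H 1 j b' 0%N); rewrite ?oner_neq0 //; try tauto.
by rewrite scale1r mul1r.
Qed.

End StandardFrame.

(** * Real dual points on support lines *)

Section RayleighMax.
Variables (R : realType) (n : nat).
Hypothesis n_gt0 : (0 < n)%N.
Local Notation C := R[i].
Local Notation "x %:C" := (real_complex R x) : ring_scope.

Lemma rayleigh_max (B : 'M[C]_n) : B^t* = B ->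
  exists l : R, (exists2 u : 'cV_n, u != 0 & B *m u = l%:C *: u) /\
    forall u, qform B u <= l%:C * qform 1%:M u.
Proof.
move=> hB.
have Bh : B \is hermsymmx by apply/is_hermitianmxP; rewrite expr0 scale1r hB.
have /orthomx_spectralP BE := hermitian_normalmx Bh.
have Pu := spectral_unitarymx B; have Pun := spectral_unit B.
have spr := hermitian_spectral_diag_real Bh.
set P := spectralmx B in BE Pu Pun; set sp := spectral_diag B in BE spr.
pose l i : R := complex.Re (sp 0 i).
have lE i : sp 0 i = (l i)%:C by rewrite RRe_real //; exact: (mxOverP spr).
have [i0 _ lmax] := @arg_maxP _ _ _ (Ordinal n_gt0) xpredT l isT.
exists (l i0); split.
  exists (invmx P *m delta_mx i0 0).
    apply: contraTneq (oner_neq0 C) => /(congr1 (mulmx P)); rewrite mulKVmx // mulmx0.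
    by move=> /matrixP/(_ i0 0); rewrite !mxE !eqxx => /eqP; rewrite (negPf (oner_neq0 _)).
  rewrite BE -!mulmxA mulKVmx // -lE scalemxAr; congr (_ *m _).
  apply/matrixP => i j; rewrite ord1 mul_diag_mx !mxE eqxx andbT.
  by case: eqVneq => [->|]; rewrite ?mulr0 // .
move=> u.
have conj D : qform (invmx P *m D *m P) u = qform D (P *m u).
  by rewrite invmx_unitary // /qform trmx_mul map_mxM !mulmxA.
rewrite BE conj; have -> : qform 1%:M u = qform 1%:M (P *m u) by rewrite -conj mulmx1 mulVmx.
move: (P *m u) => v; rewrite qform1 /qform -mulmxA mxE mulr_sumr; apply: ler_sum => i _.
rewrite mul_diag_mx !mxE mulrCA [_ * v i 0]mulrC -normCK lE ler_wpM2r ?exprn_ge0 //.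
by rewrite lecR; exact: lmax.
Qed.

End RayleighMax.

Lemma sum_ord3 (V : nmodType) (F : 'I_3 -> V) : \sum_i F i = F 0 + F 1 + F 2%:R.
Proof.
rewrite !big_ord_recl big_ord0 addr0 addrA.
by congr (F _ + F _ + F _); apply/val_inj.
Qed.

Lemma ord3P (P : 'I_3 -> Prop) : P 0 -> P 1 -> P 2%:R -> forall i, P i.
Proof.
move=> P0 P1 P2 [[|[|[|//]]] i3].
- by rewrite (_ : Ordinal i3 = 0) //; apply/val_inj.
- by rewrite (_ : Ordinal i3 = 1) //; apply/val_inj.
- by rewrite (_ : Ordinal i3 = 2%:R) //; apply/val_inj.
Qed.

Lemma euler_solve (F : fieldType) (a b p q r z : F) :
  p != 0 -> a * p + q + b * r = 0 -> r / p = z -> q = - (a + b * z) * p.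
Proof.
move=> p0 e <-; have -> : q = - (a * p + b * r).
  by apply/eqP; rewrite -addr_eq0 addrCA addrA e.
by field.
Qed.

Section RealGradient.
Variables (R : realType) (n : nat) (A : 'M[R[i]]_n).
Local Notation C := R[i].
Local Notation "x %:C" := (real_complex R x) : ring_scope.
Implicit Type f : {mpoly C[3]}.

(** Agreement with the conjugate polynomial at all naturals makes the coefficients real. *)
Lemma poly_real_deriv (q : {poly C}) : (forall x, x \is Num.real -> q.[x] \is Num.real) ->
  forall x, x \is Num.real -> q^`().[x] \is Num.real.
Proof.
move=> hq x xr.
have qr : q \is a polyOver Num.real.
  have q0 : q - map_poly Num.conj q = 0.
    apply: poly_nat_eq0 => k; rewrite hornerD hornerN.
    have -> : (map_poly Num.conj q).[k%:R] = (q.[k%:R])^*.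
      by rewrite -[in RHS]horner_map /= rmorph_nat.
    by rewrite (conj_Creal (hq _ (realn _ k))) subrr.
  apply/polyOverP => i; apply/CrealP.
  have := congr1 (fun p : {poly C} => p`_i) q0; rewrite coefB coef0 coef_map => /eqP.
  by rewrite subr_eq0 => /eqP <-.
by rewrite rpred_horner // polyOver_deriv.
Qed.

Lemma std_point_root_real f x y : mdivides f (pencil_form A) -> y \is Num.real ->
  f.@[std_point x y] = 0 -> x \is Num.real.
Proof.
move=> [g pE] yr fxy.
have : \det (pencil A (std_point x y)) = 0 by rewrite -pencil_formE pE mevalM fxy mulr0.
move=> /det0_kernel[u u0 /qform_ker]; rewrite qform_pencil !std_pointE /= mul1r => h.
have := qform_real u (pencil_coef1_herm A); have := qform_real u (pencil_coef2_herm A).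
move: (qform1_gt0 u0) h; move: (qform 1%:M u) (qform (pencil_coef1 A) u) (qform (pencil_coef2 A) u).
move=> q q1 q2 q0 h r2 r1.
have -> : x = - (q1 + y * q2) / q.
  apply: (mulIf (lt0r_neq0 q0)); rewrite divfK ?lt0r_neq0 //.
  by apply/eqP; rewrite -addr_eq0 addrA h.
apply: rpred_div; last exact: gtr0_real.
by rewrite rpredN; apply: rpredD; last exact: rpredM.
Qed.

(** The coefficients of a factor over C need not be real, but once made monic in x it is, at real y,
    a product of terms x - r with r real. *)
Lemma std_frame_real f k : mdivides f (pencil_form A) -> k != 0 ->
  lead_coef (std_frame f) = k%:P -> forall x y, x \is Num.real -> y \is Num.real ->
  k^-1 * f.@[std_point x y] \is Num.real.
Proof.
move=> fp k0 kE x y xr yr.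
set Fy := map_poly (horner_eval y) (std_frame f).
have lFy : lead_coef Fy = k.
  by rewrite lead_coef_map_eq kE /= /horner_eval hornerC.
have [s sE] := closed_field_poly_normal Fy; rewrite lFy in sE.
rewrite -[f.@[_]]horner_in_frame -/(std_frame f) horner2_eval -/Fy sE hornerZ mulKf //.
rewrite horner_prod big_seq rpred_prod // => r rs; rewrite hornerXsubC rpredB //.
apply: (std_point_root_real fp yr); rewrite -horner_in_frame -/(std_frame f) horner2_eval -/Fy.
by apply/rootP; rewrite sE rootZ // root_prod_XsubC.
Qed.

Lemma dual_irreducible_scale f (x : 'rV[C]_3) t : t != 0 ->
  dual_irreducible f x -> dual_irreducible f (t *: x).
Proof.
move=> t0 fx Z [Zc SZ]; have := fx Z (conj Zc SZ); case: Zc => G [Gh ->] [x0 hx].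
split; first by rewrite scaler_eq0 negb_or t0.
move=> g Gg; have [d gd] := Gh g Gg.
rewrite (@meval_eq _ _ _ (fun i => t * x 0 i)) => [|i]; last by rewrite mxE.
by rewrite (dhomog_meval _ _ gd) hx // mulr0.
Qed.

Lemma dual_irreducible_gradient f (y : 'rV[C]_3) : y != 0 -> f.@[y 0] = 0 -> gradient f y != 0 ->
  dual_irreducible f (gradient f y).
Proof. by move=> y0 fy gy Z [_ SZ]; apply: SZ; exists y. Qed.

(** The gradient divided by its first coordinate is a chart point. It is real because f / k takes
    real values at real points, and Euler's identity places it on the required line. *)
Lemma real_dual_point_at_root f (a b : R) : mdivides f (pencil_form A) ->
  f.@[std_point a%:C b%:C] = 0 -> f^`M(0).@[std_point a%:C b%:C] != 0 ->
  exists2 z : C, dual_irreducible f (map_mx (real_complex R) (chart_point z)) &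
    a + complex.Re z + b * complex.Im z = 0.
Proof.
move=> fp fab d0.
have [d fd] := pencil_factor_homog fp.
have [k k0 kE] := std_frame_lead fp.
have ar : a%:C \is Num.real by rewrite complex_real.
have br : b%:C \is Num.real by rewrite complex_real.
have rl := std_frame_real fp k0 kE.
set y := std_point a%:C b%:C in fab d0.
have d0r : k^-1 * f^`M(0).@[y] \is Num.real.
  rewrite /y -std_frame_derivX horner_derivX -hornerZ -derivZ.
  apply: poly_real_deriv => // x xr; rewrite hornerZ -horner2_eval horner_in_frame.
  exact: rl.
have d2r : k^-1 * f^`M(2%:R).@[y] \is Num.real.
  rewrite /y -std_frame_derivY horner_derivY -hornerZ -derivZ.
  apply: poly_real_deriv => // x xr; rewrite hornerZ horner_in_frame.
  exact: rl.
have /complex_realP[z2 z2E] : f^`M(2%:R).@[y] / f^`M(0).@[y] \is Num.real.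
  have -> : f^`M(2%:R).@[y] / f^`M(0).@[y] = (k^-1 * f^`M(2%:R).@[y]) / (k^-1 * f^`M(0).@[y]).
    by rewrite -mulf_div divff ?invr_eq0 // mul1r.
  exact: rpred_div d2r d0r.
have euler : a%:C * f^`M(0).@[y] + f^`M(1).@[y] + b%:C * f^`M(2%:R).@[y] = 0.
  have := euler_identity y fd; rewrite fab mulr0 sum_ord3.
  have -> : y 0 = a%:C by rewrite /y std_pointE.
  have -> : y 1 = 1 by rewrite /y std_pointE.
  have -> : y 2%:R = b%:C by rewrite /y std_pointE.
  by rewrite mul1r.
pose z1 : R := - (a + b * z2).
exists (Complex z1 z2); last by rewrite /z1 /=; ring.
pose yr : 'rV[C]_3 := \row_i y i.
have yE g : g.@[yr 0] = g.@[y] by apply: meval_eq => i; rewrite mxE.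
have -> : map_mx (real_complex R) (chart_point (Complex z1 z2)) = (f^`M(0).@[y])^-1 *: gradient f yr.
  have d1 : f^`M(1).@[y] = z1%:C * f^`M(0).@[y].
    by rewrite /z1 rmorphN rmorphD rmorphM; exact: euler_solve d0 euler z2E.
  apply/rowP; apply: ord3P; rewrite !mxE yE /=.
  - rewrite (mulVf d0); exact: rmorph1.
  - rewrite d1 mulrC (mulfK d0); exact: erefl.
  - rewrite -z2E mulrC; exact: erefl.
apply: dual_irreducible_scale; first by rewrite invr_eq0.
apply: dual_irreducible_gradient; last 1 first.
- apply: contraNneq d0 => /rowP/(_ 0); rewrite !mxE yE => ->; by [].
- apply/eqP => /rowP/(_ 1); rewrite !mxE /y std_pointE /= => /eqP.
  by rewrite (negPf (oner_neq0 C)).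
by rewrite yE.
Qed.

End RealGradient.

Lemma qform_lincomb (C : numClosedFieldType) n (B1 B2 : 'M[C]_n) a b u :
  qform (a *: B1 + b *: B2) u = a * qform B1 u + b * qform B2 u.
Proof. by rewrite qformD !qformZ. Qed.

Section SupportPoints.
Variables (R : realType) (n : nat).
Hypothesis n_gt0 : (0 < n)%N.
Local Notation C := R[i].
Local Notation "x %:C" := (real_complex R x) : ring_scope.
Variable A : 'M[C]_n.

Lemma numerical_range_support (y1 y2 : R) : exists l : R,
  (exists2 u : 'cV_n, u != 0 &
     (y1%:C *: pencil_coef1 A + y2%:C *: pencil_coef2 A) *m u = l%:C *: u) /\
  forall z, numerical_range A z -> y1 * complex.Re z + y2 * complex.Im z <= l.
Proof.
set B := _ + _.
have hB : B^t* = B.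
  have -> : B = pencil A (fun i => ([:: 0; y1; y2]`_i)%:C).
    by rewrite /pencil /= rmorph0 scale0r add0r.
  by apply: pencil_real_herm => i; rewrite complex_real.
have [l [hu hmax]] := rayleigh_max n_gt0 hB; exists l; split=> // z /numerical_rangeP[w w0 wz].
have q0 := qform1_gt0 w0.
have := hmax w; rewrite {1}/B qform_lincomb.
have := pencil_coefE A w; rewrite wz.
have := qform_real w (pencil_coef1_herm A); have := qform_real w (pencil_coef2_herm A).
have : qform 1%:M w \is Num.real by rewrite gtr0_real.
move: q0.
move: (qform 1%:M w) (qform (pencil_coef1 A) w) (qform (pencil_coef2 A) w) => q x1 x2 q0.
move=> /complex_realP[q' qE] /complex_realP[x2' ->] /complex_realP[x1' ->].
rewrite {}qE in q0 *; rewrite complex_iE.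
case: z {wz} => [z1 z2] /eqP; rewrite eq_complex /= => /andP[/eqP h1 /eqP h2].
have -> : x1' = z1 * q'.
  have -> : x1' = x1' + (0 * x2' - 1 * 0) by ring.
  by rewrite -h1; ring.
have -> : x2' = z2 * q'.
  have -> : x2' = 0 + (0 * 0 + 1 * x2') by ring.
  by rewrite -h2; ring.
rewrite lecE /= !mul0r !subr0 !mulrA -mulrDl => /andP[_].
by rewrite ler_pM2r // -ltcR.
Qed.

Variable s : seq {mpoly C[3]}.
Hypothesis s_irr : forall f, f \in s -> mirreducible f.
Hypothesis s_prod : pencil_form A = \prod_(f <- s) f.

(** Restriction to the finite list s, instead of all irreducible divisors, makes this a finite union
    of closed sets. *)
Definition factor_dual_points : set C :=
  [set z | exists2 f, f \in s & dual_irreducible f (map_mx (real_complex R) (chart_point z))].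

Lemma factor_divides f : f \in s -> mdivides f (pencil_form A).
Proof.
move=> fs; exists (\prod_(g <- rem f s) g); rewrite s_prod mulrC.
by rewrite (perm_big _ (perm_to_rem fs)) big_cons.
Qed.

Lemma factor_dual_points_real z : factor_dual_points z ->
  real_dual_points (pencil_form A) (chart_point z).
Proof. by move=> [f fs fz]; exists f; split=> //; [exact: s_irr|exact: factor_divides]. Qed.

Lemma factor_discriminant : exists2 r : {poly C}, r != 0 & forall f, f \in s ->
  forall x y, f.@[std_point x y] = 0 -> f^`M(0).@[std_point x y] = 0 -> r.[y] = 0.
Proof.
have : forall f, f \in s -> mirreducible f /\ mdivides f (pencil_form A).
  by move=> f fs; split; [exact: s_irr|exact: factor_divides].
elim: s => [|f t IHt] ht; first by exists 1; rewrite ?oner_neq0.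
have [|r r0 hr] := IHt; first by move=> g gt; apply: ht; rewrite inE gt orbT.
have [firr fp] := ht f (mem_head _ _).
have [r' r'0 hr'] := irreducible_squarefree firr fp.
exists (r' * r); first by rewrite mulf_neq0.
move=> g; rewrite inE => /orP[/eqP->|gt] x y gx g'x; rewrite hornerM.
  by rewrite (hr' x) // mul0r.
by rewrite (hr g gt x) // mulr0.
Qed.

Lemma pencil_root_dual_point (r : {poly C}) (a b : R) :
  (forall f, f \in s -> forall x y, f.@[std_point x y] = 0 ->
     f^`M(0).@[std_point x y] = 0 -> r.[y] = 0) ->
  r.[b%:C] != 0 -> \det (pencil A (std_point a%:C b%:C)) = 0 ->
  exists2 q, factor_dual_points q & a + complex.Re q + b * complex.Im q = 0.
Proof.
move=> hr rb; rewrite -pencil_formE s_prod rmorph_prod => /eqP.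
rewrite prodf_seq_eq0 => /hasP[f fs /= /eqP fab].
have d0 : f^`M(0).@[std_point a%:C b%:C] != 0.
  by apply: contraNneq rb => d0; apply/eqP; apply: hr fs _ _ fab d0.
have [q fq qE] := real_dual_point_at_root (factor_divides fs) fab d0.
by exists q => //; exists f.
Qed.

Lemma factor_dual_support : exists2 r : {poly C}, r != 0 & forall c : R, r.[c%:C] != 0 ->
  forall z, numerical_range A z ->
    (exists2 q, factor_dual_points q &
       complex.Re z + c * complex.Im z <= complex.Re q + c * complex.Im q) /\
    (exists2 q, factor_dual_points q &
       complex.Re q + c * complex.Im q <= complex.Re z + c * complex.Im z).
Proof.
have [r r0 hr] := factor_discriminant; exists r => // c rc z Wz; split.
  have [l [[u u0 Bu] lmax]] := numerical_range_support 1 c.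
  have [|q qQ qE] := @pencil_root_dual_point r (- l) c hr rc.
    apply: (kernel_det0 u0); rewrite /pencil !std_pointE /= rmorphN.
    rewrite rmorph1 scale1r in Bu.
    by rewrite -addrA scale1r mulmxDl Bu -scalemxAl /pencil_coef0 mul1mx scaleNr addNr.
  exists q => //; have := lmax z Wz; rewrite mul1r => /le_trans; apply.
  by rewrite -subr_ge0 addrC addrA qE.
(* In the opposite direction l is minus the least eigenvalue of A_1 + c A_2, so the root again lies
   over y_2 = c. *)
have [l [[u u0 Bu] lmax]] := numerical_range_support (- 1) (- c).
have [|q qQ qE] := @pencil_root_dual_point r l c hr rc.
  apply: (kernel_det0 u0); rewrite /pencil !std_pointE /=.
  rewrite !rmorphN rmorph1 !scaleNr scale1r -opprD mulNmx in Bu.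
  rewrite -addrA scale1r mulmxDl -scalemxAl /pencil_coef0 mul1mx -Bu.
  exact: addNr.
exists q => //; have := lmax z Wz; rewrite mulN1r mulNr -opprD lerNl.
have -> // : complex.Re q + c * complex.Im q = - l.
by apply/eqP; rewrite -addr_eq0 addrC addrA qE.
Qed.

End SupportPoints.

(** * Nearest points of three-point convex hulls *)

Section Caratheodory.
Variable R : realType.
Local Notation C := R[i].
Local Notation "x %:C" := (real_complex R x) : ring_scope.
Implicit Type S : set C.

(** The fixed number of points gives a parametrization by a fixed number of real coordinates. *)
Definition hull3 S : set C :=
  [set z | exists (t : 'I_3 -> R) (q : 'I_3 -> C),
     [/\ forall j, 0 <= t j, \sum_j t j = 1, forall j, S (q j) & z = \sum_j (t j)%:C * q j]].

(** Four vectors (1, Re q, Im q) in a space of dimension 3 are dependent; the sign is chosen so that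
    some weight is positive. *)
Lemma affine_dependence (q : 'I_4 -> C) : exists l : 'I_4 -> R,
  [/\ exists i, 0 < l i, \sum_j l j = 0 & \sum_j (l j)%:C * q j = 0].
Proof.
pose M : 'M[R]_(4, 3) := \matrix_(i, k) [:: 1; complex.Re (q i); complex.Im (q i)]`_k.
have : kermx M != 0.
  rewrite -mxrank_eq0 mxrank_ker -lt0n subn_gt0.
  by apply: leq_ltn_trans (rank_leq_col M) _.
case/rowV0Pn => v /sub_kermxP vM v0.
have vME k : \sum_j v 0 j * M j k = 0.
  by have := congr1 (fun B : 'rV[R]_3 => B 0 k) vM; rewrite !mxE.
have v1 : \sum_j v 0 j = 0.
  by rewrite -[RHS](vME 0); apply: eq_bigr => j _; rewrite mxE mulr1.
have vq : \sum_j (v 0 j)%:C * q j = 0.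
  have := vME 1; have := vME 2%:R.
  rewrite (eq_bigr (fun j => v 0 j * complex.Im (q j))) => [h2|j _]; last by rewrite mxE.
  rewrite (eq_bigr (fun j => v 0 j * complex.Re (q j))) => [h1|j _]; last by rewrite mxE.
  apply/eqP; rewrite eq_complex /=; apply/andP; split; apply/eqP.
    rewrite -[RHS]h1 raddf_sum; apply: eq_bigr => j _.
    by case: (q j) => x y /=; rewrite mul0r subr0.
  rewrite -[RHS]h2 raddf_sum; apply: eq_bigr => j _.
  by case: (q j) => x y /=; rewrite mul0r addr0.
have [i vi] : exists i, v 0 i != 0.
  by move/rV0Pn: v0.
have [vi0|vi0|vi0] := ltgtP (v 0 i) 0; last by rewrite vi0 eqxx in vi.
  exists (fun j => - v 0 j); split; first by exists i; rewrite oppr_gt0.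
    by rewrite sumrN v1 oppr0.
  rewrite -[RHS]oppr0 -[in RHS]vq -sumrN; apply: eq_bigr => j _.
  by rewrite rmorphN mulNr.
by exists (fun j => v 0 j); split => //; exists i.
Qed.

Lemma caratheodory4 S (t : 'I_4 -> R) (q : 'I_4 -> C) :
  (forall j, 0 <= t j) -> \sum_j t j = 1 -> (forall j, S (q j)) ->
  hull3 S (\sum_j (t j)%:C * q j).
Proof.
move=> t0 t1 Sq.
have [l [[i0 li0] l0 lq]] := affine_dependence q.
have [i li imin] := @arg_minP _ _ _ i0 (fun j => 0 < l j) (fun j => t j / l j) li0.
(* The largest multiple of l that can be subtracted from t without a negative weight; it removes the
   point of index i. *)
pose c := t i / l i; have c0 : 0 <= c by rewrite divr_ge0 // ltW.
pose t' j := t j - c * l j.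
have t'i : t' i = 0 by rewrite /t' /c divfK ?subrr // gt_eqF.
have t'0 j : 0 <= t' j.
  rewrite subr_ge0; have [lj|lj] := ltP 0 (l j).
    by rewrite -ler_pdivlMr //; exact: imin.
  by rewrite (le_trans _ (t0 j)) // mulr_ge0_le0.
have t'1 : \sum_j t' j = 1 by rewrite /t' sumrB -mulr_sumr l0 mulr0 subr0.
have t'q : \sum_j (t j)%:C * q j = \sum_j (t' j)%:C * q j.
  have lc : \sum_j c%:C * ((l j)%:C * q j) = 0 by rewrite -mulr_sumr lq mulr0.
  rewrite [RHS](eq_bigr (fun j => (t j)%:C * q j - c%:C * ((l j)%:C * q j))) => [|j _].
    by rewrite sumrB lc subr0.
  by rewrite /t' rmorphB rmorphM mulrBl mulrA.
have drop (V : nmodType) (F : 'I_4 -> V) : F i = 0 -> \sum_j F j = \sum_(k < 3) F (lift i k).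
  by move=> Fi; rewrite (bigD1_ord i) //= Fi add0r.
rewrite t'q drop; last by rewrite t'i mul0r.
exists (fun k => t' (lift i k)), (fun k => q (lift i k)); split=> //.
by rewrite -t'1 [RHS]drop.
Qed.

(** One more point makes four, which [caratheodory4] reduces to three. Segments towards points of S
    are all that [nearest_point_separates] asks for. *)
Lemma hull3_segment S a b (t : R) : 0 <= t <= 1 -> hull3 S a -> S b ->
  hull3 S ((1 - t)%:C * a + t%:C * b).
Proof.
move=> /andP[t0 t1] [u [q [u0 u1 Sq ->]]] Sb.
pose v (j : 'I_4) := oapp (fun k => (1 - t) * u k) t (unlift ord0 j).
pose r (j : 'I_4) := oapp q b (unlift ord0 j).
have -> : (1 - t)%:C * (\sum_j (u j)%:C * q j) + t%:C * b = \sum_j (v j)%:C * r j.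
  rewrite [RHS]big_ord_recl /v /r unlift_none /= addrC mulr_sumr; congr (_ + _).
  by apply: eq_bigr => j _; rewrite liftK /= rmorphM mulrA.
apply: caratheodory4 => [j||j].
- by rewrite /v; case: (unlift _ _) => //= k; rewrite mulr_ge0 // subr_ge0.
- rewrite big_ord_recl /v unlift_none /= (eq_bigr (fun k => (1 - t) * u k)) => [|k _]; last by rewrite liftK.
  by rewrite -mulr_sumr u1 mulr1 addrC subrK.
- by rewrite /r; case: (unlift _ _).
Qed.

End Caratheodory.

Section NearestPoint.
Variable R : realType.
Local Notation C := R[i].
Local Notation "x %:C" := (real_complex R x) : ring_scope.
Variables (S : set C) (B : R).
Let chart (z : C) : 'I_3 -> C := fun i => (chart_point z 0 i)%:C.
Hypothesis S_closed : forall z,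
  (forall h : {mpoly C[3]}, (forall z', S z' -> h.@[chart z'] = 0) -> h.@[chart z] = 0) -> S z.
Hypothesis S_bounded : forall z, S z -> `|complex.Re z| <= B /\ `|complex.Im z| <= B.
Hypothesis S_nonempty : exists z, S z.

(* Weights are squares, which makes their simplex a real algebraic set. *)
Let wt (x : 'rV[R]_(3 + (3 + 3))) (k : 'I_3) : R := x 0 (lshift (3 + 3) k).
Let pt (x : 'rV[R]_(3 + (3 + 3))) (k : 'I_3) : C :=
  Complex (x 0 (rshift 3 (lshift 3 k))) (x 0 (rshift 3 (rshift 3 k))).
Let comb x : C := \sum_k (wt x k ^+ 2)%:C * pt x k.

(** Weights and points together form a bounded real algebraic set in dimension 9: the squares sum to
    1, and the points satisfy all polynomials that vanish on S. *)
Lemma hull3_nearest z : exists2 a, hull3 S a &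
  forall b, hull3 S b -> cdot (z - a) (z - a) <= cdot (z - b) (z - b).
Proof.
have pt_poly k : cpolyfun (fun x => pt x k) by split; exact: polyfun_coord.
have wt_poly k : cpolyfun (fun x => (wt x k ^+ 2)%:C).
  by split; [apply: polyfunX; exact: polyfun_coord | exact: polyfun_const].
have [cr ci] : cpolyfun (fun x => z - comb x).
  apply: cpolyfunD; first exact: cpolyfun_const.
  apply: (@cpolyfun_ext _ _ (fun x => (-1) * comb x)) => [x|]; first by rewrite mulN1r.
  apply: cpolyfunM; first exact: cpolyfun_const.
  by apply: cpolyfun_sum => k; apply: cpolyfunM.
have chart_poly k i : cpolyfun (fun x => chart (pt x k) i).
  apply: (@cpolyfun_ext _ _ (fun x => ([:: 1; complex.Re (pt x k); complex.Im (pt x k)]`_i)%:C)).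
    by move=> x; rewrite /chart mxE.
  have [hr hi] := pt_poly k.
  split; last exact: polyfun_const.
  by case: i => [[|[|[|//]]] ?] //=; exact: polyfun_const.
pose G : set ('rV[R]_(3 + (3 + 3)) -> R) :=
  [set g | g = (fun x => \sum_k wt x k ^+ 2 - 1) \/
     exists k (h : {mpoly C[3]}), (forall z', S z' -> h.@[chart z'] = 0) /\
       (g = (fun x => complex.Re h.@[chart (pt x k)]) \/
        g = (fun x => complex.Im h.@[chart (pt x k)]))].
have GE x : (forall g, G g -> g x = 0) <-> \sum_k wt x k ^+ 2 = 1 /\ forall k, S (pt x k).
  split=> [hx|[h1 hS] g].
    split; first by apply/eqP; rewrite -subr_eq0; apply/eqP; apply: (hx (fun x => _)); left.
    move=> k; apply: S_closed => h hS; apply/eqP; rewrite eq_complex /=; apply/andP; split; apply/eqP.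
      by apply: (hx (fun x => _)); right; exists k, h; split=> //; left.
    by apply: (hx (fun x => _)); right; exists k, h; split=> //; right.
  move=> [->|[k [h [hh [->|->]]]]]; first by rewrite h1 subrr.
    by rewrite hh.
  by rewrite hh.
have hull_comb x : (forall g, G g -> g x = 0) -> hull3 S (comb x).
  move=> /GE[h1 hS]; exists (fun k => wt x k ^+ 2), (pt x); split=> // j.
  exact: sqr_ge0.
have comb_hull b : hull3 S b -> exists2 x, (forall g, G g -> g x = 0) & comb x = b.
  move=> [t [q [t0 t1 Sq ->]]].
  pose x : 'rV[R]_(3 + (3 + 3)) := row_mx (\row_k Num.sqrt (t k))
    (row_mx (\row_k complex.Re (q k)) (\row_k complex.Im (q k))).
  have wE k : wt x k ^+ 2 = t k by rewrite /wt /x row_mxEl mxE sqr_sqrtr.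
  have pE k : pt x k = q k.
    by rewrite /pt /x !row_mxEr row_mxEl !mxE; case: (q k).
  exists x; last by apply: eq_bigr => k _; rewrite wE pE.
  apply/GE; split; first by rewrite -t1; apply: eq_bigr => k _; exact: wE.
  by move=> k; rewrite pE.
have [||||x Zx xmin] := @polyfun_min R _ G (fun x => cdot (z - comb x) (z - comb x)) (Num.max 1 B).
- move=> g [->|[k [h [_ hg]]]].
    apply: polyfunD; last exact: polyfun_const.
    by apply: polyfun_sum => k _; apply: polyfunX; exact: polyfun_coord.
  have [hr hi] := cpolyfun_meval h (chart_poly k).
  by case: hg => ->.
- by apply: polyfunD; apply: polyfunM.
- have [z0 Sz0] := S_nonempty.
  have [|x xZ _] := comb_hull z0; last by exists x.
  exists (fun k : 'I_3 => (k == 0)%:R), (fun=> z0); split=> //.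
    by rewrite (bigD1 0) //= big1 ?addr0 // => k /negPf->.
  rewrite (bigD1 0) //= big1 ?addr0 ?rmorph1 ?mul1r // => k /negPf->.
  by rewrite rmorph0 mul0r.
- move=> x /GE[h1 hS] i; case: (split_ordP i) => [k ->|j ->].
    rewrite le_max -(@ler_pXn2r _ 2) ?nnegrE // expr1n real_normK ?num_real // -h1.
    by rewrite (bigD1 k) //= lerDl sumr_ge0 // => l _; rewrite sqr_ge0.
  rewrite le_max; apply/orP; right.
  by case: (split_ordP j) => k ->; have [h2 h3] := S_bounded (hS k).
exists (comb x); first exact: hull_comb.
by move=> b /comb_hull[y Zy <-]; exact: xmin.
Qed.

End NearestPoint.

Lemma sub_convex_comb (K : comRingType) (x z a b : K) :
  (1 - x) * (z - a) + x * (z - b) = z - ((1 - x) * a + x * b).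
Proof. by ring. Qed.

(** * The numerical range lies in the hull of the dual points *)

Section RangeInHull.
Variables (R : realType) (n : nat).
Hypothesis n_gt0 : (0 < n)%N.
Local Notation C := R[i].
Local Notation "x %:C" := (real_complex R x) : ring_scope.
Variable A : 'M[C]_n.
Variable s : seq {mpoly C[3]}.
Hypothesis s_irr : forall f, f \in s -> mirreducible f.
Hypothesis s_prod : pencil_form A = \prod_(f <- s) f.
Let Q := factor_dual_points s.
Let chart (z : C) : 'I_3 -> C := fun i => (chart_point z 0 i)%:C.

(** A point outside the dual of each factor is separated from each by a polynomial; the product over
    the finite list separates it from Q. *)
Lemma factor_dual_points_zeros z :
  (forall h : {mpoly C[3]}, (forall z', Q z' -> h.@[chart z'] = 0) -> h.@[chart z] = 0) -> Q z.
Proof.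
move=> hz; apply: contrapT => Qz.
pose X z' : 'rV[C]_3 := map_mx (real_complex R) (chart_point z').
have XE (h : {mpoly C[3]}) z' : h.@[X z' 0] = h.@[chart z'].
  by apply: meval_eq => i; rewrite mxE.
have sep f : f \in s -> exists2 h : {mpoly C[3]}, h.@[chart z] != 0 &
    forall z', dual_irreducible f (X z') -> h.@[chart z'] = 0.
  move=> fs.
  have : ~ dual_irreducible f (X z) by move=> fz; apply: Qz; exists f.
  move=> nz; apply: contrapT => nh; apply: nz => Z [[G [Gh ZE]] SZ].
  rewrite ZE; split.
    by apply/eqP => /rowP/(_ 0); rewrite !mxE /= => /eqP; rewrite (negPf (oner_neq0 C)).
  move=> g Gg; apply/eqP; apply: contrapT => /negP gz; apply: nh; exists g; first by rewrite -XE.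
  move=> z' fz'; rewrite -XE.
  have : Z (X z') by apply: fz'; split=> //; exists G.
  by rewrite ZE => -[_]; apply.
have [h hz0 hS] : exists2 h : {mpoly C[3]}, h.@[chart z] != 0 & forall z', Q z' -> h.@[chart z'] = 0.
  rewrite /Q /factor_dual_points; move: sep; elim: (s) => [|f t IHt] sep.
    by exists 1; [rewrite meval1 oner_neq0 | move=> z' []].
  have [h1 h1z h1S] := sep f (mem_head _ _).
  have [|h2 h2z h2S] := IHt; first by move=> g gt; apply: sep; rewrite inE gt orbT.
  exists (h1 * h2); first by rewrite mevalM mulf_neq0.
  move=> z' [g]; rewrite inE => /orP[/eqP->|gt] gz'; rewrite mevalM.
    by rewrite h1S // mul0r.
  by rewrite h2S ?mulr0 //; exists g.
by move: hz0; rewrite hz // eqxx.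
Qed.

Lemma numerical_range_bounded : exists B : R, forall z, numerical_range A z ->
  `|complex.Re z| <= B /\ `|complex.Im z| <= B.
Proof.
have [a [_ ha]] := numerical_range_support n_gt0 A 1 0.
have [b [_ hb]] := numerical_range_support n_gt0 A (-1) 0.
have [c [_ hc]] := numerical_range_support n_gt0 A 0 1.
have [d [_ hd]] := numerical_range_support n_gt0 A 0 (-1).
exists (Num.max (Num.max a b) (Num.max c d)) => z Wz.
have := ha z Wz; have := hb z Wz; have := hc z Wz; have := hd z Wz.
rewrite !mul0r !mul1r !mulN1r !addr0 !add0r => h1 h2 h3 h4.
by rewrite !ler_norml ![- Num.max _ _ <= _]lerNl !le_max h1 h2 h3 h4 !orbT.
Qed.

(** A change of the direction by at most e in each coordinate alters the value at (u, v) by at most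
    2 e M, less than the gap |d|^2. *)
Lemma tilted_separation (d1 d2 a1 a2 u v e M : R) :
  `|a1 - d1| <= e -> `|a2 - d2| <= e -> `|u| <= M -> `|v| <= M ->
  e * (2 * M) < d1 ^+ 2 + d2 ^+ 2 -> d1 * u + d2 * v <= - (d1 ^+ 2 + d2 ^+ 2) ->
  a1 * u + a2 * v < 0.
Proof.
move=> h1 h2 hu hv hM hd.
have -> : a1 * u + a2 * v = d1 * u + d2 * v + ((a1 - d1) * u + (a2 - d2) * v) by ring.
have m1 : (a1 - d1) * u <= e * M.
  by apply: le_trans (ler_norm _) _; rewrite normrM ler_pM.
have m2 : (a2 - d2) * v <= e * M.
  by apply: le_trans (ler_norm _) _; rewrite normrM ler_pM.
by lra.
Qed.

Lemma real_affine_nonroot (r : {poly C}) (a b e : R) : r != 0 -> a != 0 -> 0 < e ->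
  exists s : R, [/\ 0 < s, s <= e & r.[((b + s) / a)%:C] != 0].
Proof.
move=> r0 a0 e0.
pose p : {poly C} := ((b / a)%:C)%:P + (a^-1)%:C *: 'X.
have aC : (a^-1)%:C != 0 :> C by rewrite fmorph_eq0 invr_eq0.
have sp : size p = 2 by rewrite /p addrC size_polyDl size_scale // ?size_polyX // size_polyC; case: eqP.
have rp0 : r \Po p != 0 by rewrite comp_poly_eq0 // sp.
have eC : 0 < e%:C :> C by rewrite ltcR.
have [x [x0 xe rx]] := exists_small_nonroot rp0 eC.
have /complex_realP[t tE] : x \is Num.real by rewrite gtr0_real.
rewrite tE ltcR in x0; rewrite tE lecR in xe; exists t; split=> //.
move: rx; rewrite tE horner_comp /p hornerD hornerC hornerZ hornerX -rmorphM -rmorphD.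
by rewrite mulrDl [t / a]mulrC.
Qed.

Lemma numerical_range_in_hull z : numerical_range A z -> hull3 Q z.
Proof.
move=> Wz.
have QW q : Q q -> numerical_range A q.
  by move=> Qq; apply: real_dual_points_in_range => //; exact: factor_dual_points_real Qq.
have [B WB] := numerical_range_bounded.
have QB q : Q q -> `|complex.Re q| <= B /\ `|complex.Im q| <= B by move=> /QW/WB.
have [r r0 hr] := factor_dual_support n_gt0 s_irr s_prod.
have Q0 : exists q, Q q.
  have [x [x0 _ rx]] := exists_small_nonroot r0 ltr01.
  have /complex_realP[c cE] : x \is Num.real by rewrite gtr0_real.
  rewrite cE in rx; have [[q Qq _] _] := hr c rx z Wz; by exists q.
have [a Ha amin] := hull3_nearest factor_dual_points_zeros QB Q0 z.
have [za|za] := eqVneq (z - a) 0.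
  by move/eqP: za; rewrite subr_eq0 => /eqP->.
have d0 := cdot_gt0 za.
have sep q : Q q -> cdot (z - a) (z - a) <= cdot (z - a) (z - q).
  move=> Qq; pose S' := [set z - q' | q' in Q] : set C.
  apply: (@nearest_point_separates _ S') => [b t [q' Qq' <-] t01|]; last by exists q.
  have -> : (1 - t)%:C * (z - a) + t%:C * (z - q') = z - ((1 - t)%:C * a + t%:C * q').
    by rewrite !(rmorphB, rmorph1) sub_convex_comb.
  by apply: amin; exact: hull3_segment.
move: (z - a) d0 sep => d d0 sep {za amin}.
move: WB QB hr Wz sep d0; rewrite /cdot.
case: z => z1 z2; case: d => d1 d2 /= WB QB hr Wz sep d0.
have [Bz1 Bz2] := WB _ Wz; rewrite /= in Bz1 Bz2.
have B0 : 0 <= B by apply: le_trans Bz1.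
(* The coordinates of w - z are bounded by M = 2B for w in Q, so the tilt must satisfy 4 B e <
   |d|^2. *)
pose e := (d1 * d1 + d2 * d2) / (4 * B + 1).
have e0 : 0 < e by rewrite divr_gt0 // ltr_wpDl // mulr_ge0.
(* Support points are known only in directions proportional to (1, c), so the first coordinate is
   made nonzero; the second is then moved by x to make c generic. *)
pose a1 := if d1 == 0 then e else d1.
have a10 : a1 != 0 by rewrite /a1; case: ifP => [_|/negbT//]; rewrite gt_eqF.
have a1d : `|a1 - d1| <= e.
  by rewrite /a1; case: eqP => [->|_]; rewrite ?subr0 ?subrr ?normr0 ?gtr0_norm // ltW.
have [x [x0 xe rx]] := real_affine_nonroot d2 r0 a10 e0.
have [[q Qq hq] [q' Qq' hq']] := hr _ rx _ Wz; rewrite /= in hq hq'.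
have tilt w : Q w -> a1 * (complex.Re w - z1) + (d2 + x) * (complex.Im w - z2) < 0.
  move=> Qw; have [Bw1 Bw2] := QB _ Qw.
  have hsep := sep _ Qw; case: w Qw Bw1 Bw2 hsep => w1 w2 /= _ Bw1 Bw2 hsep.
  apply: (@tilted_separation d1 d2 _ _ _ _ e (2 * B)) => //.
  - by rewrite addrC addKr gtr0_norm.
  - by apply: le_trans (ler_normB _ _) _; lra.
  - by apply: le_trans (ler_normB _ _) _; lra.
  - rewrite /e mulrAC ltr_pdivrMr; last by lra.
    rewrite !expr2; move: d0; set D := d1 * d1 + _ => d0; nra.
  - by nra.
have axE u v : a1 * u + (d2 + x) * v = a1 * (u + (d2 + x) / a1 * v) by field.
(* Dividing by a1 may reverse the inequality; its sign selects which of the two support points gives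
   the contradiction. *)
have [a1n|a1p] := ltP a1 0.
  have := tilt _ Qq'; rewrite axE nmulr_rlt0 // => ?; lra.
have a1p' : 0 < a1 by rewrite lt_def a10.
have := tilt _ Qq; rewrite axE pmulr_rlt0 // => ?; lra.
Qed.

End RangeInHull.

Theorem lemma3 (R : realType) (n : nat) (hn : (0 < n)%N) (A : 'M[R[i]]_n) :
  numerical_range A =
  convex_hull [set z : R[i] | real_dual_points (pencil_form A) (chart_point z)].
Proof.
apply/seteqP; split=> z.
  move=> Wz.
  have pu : pencil_form A \isn't a GRing.unit.
    apply/negP; rewrite mpoly_unit_msize => /msize_poly1P[c c0 pc].
    have := pencil_form_homog A; rewrite pc => /dhomogP/(_ 0%MM).
    rewrite mcoeff_msupp mcoeffC eqxx mulr1 => /(_ c0) /=; rewrite mdeg0 => n0.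
    by rewrite -n0 in hn.
  have [s s_irr s_prod] := irreducible_factorization (pencil_form_neq0 A) pu.
  have [t [q [t0 t1 Qq zE]]] := numerical_range_in_hull hn s_irr s_prod Wz.
  exists 3, t, q; split=> // j; exact: (factor_dual_points_real s_irr s_prod (Qq j)).
move=> [m [t [q [t0 t1 Qq ->]]]].
apply: numerical_range_convex_sum => // j; exact: (real_dual_points_in_range hn (Qq j)).
Qed.
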